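(* Let $G$ be a countable, discrete, sofic group with sofic approximation $\sigma_k\colon G\to S_{d_k}$. Suppose that $(\sigma_k)_k$ has ergodic commutant. Fix an algebraic action $G\curvearrowright X$, and let $\rho$ be a compatible metric on $X$. Then the following are equivalent: (i) There does not exist a sequence $\mu_k\in\mathrm{Prob}(X^{d_k})$ which is asymptotically supported on topological microstates and which locally weak$^*$-converges to $m_X$ as $k\to\infty$. (ii) There is a proper, closed, $G$-invariant subgroup $Y$ of $X$ with the following property. Given any sequence $(\phi_k)_k\in\prod_kX^{d_k}$ of topological microstates, there is a strictly increasing sequence $(k_l)_l$ of natural numbers which satisfies \[\lim_{l\to\infty}\rho_2(\phi_{k_l},Y^{d_{k_l}})=0.\]
   Context: $S_n=\mathrm{Sym}(n)$ is the symmetric group on $\{1,\dots,n\}$, $u_n$ the uniform probability measure on $\{1,\dots,n\}$, $d_{\mathrm{Hamm}}(p,q)=u_n(\{j:p(j)\ne q(j)\})$. A sofic approximation of $G$ is a sequence of maps $\sigma_k\colon G\to S_{d_k}$ (not necessarily homomorphisms) with $d_k\to\infty$, $d_{\mathrm{Hamm}}(\sigma_k(gh),\sigma_k(g)\sigma_k(h))\to 0$ for all $g,h$ and $d_{\mathrm{Hamm}}(\sigma_k(g),\sigma_k(h))\to 1$ for $g\neq h$. An algebraic action is an action by continuous automorphisms of a compact metrizable group $X$; $m_X$ is the Haar probability measure. Ergodic commutant. The commutant $\mathcal G'$ of $(\sigma_k)_k$ is the set of sequences $(\tau_k)_k\in\prod_kS_{d_k}$ with $\lim_{k\to\infty}d_{\mathrm{Hamm}}(\sigma_k(g)\tau_k,\tau_k\sigma_k(g))=0$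 for all $g\in G$. $(\sigma_k)_k$ has ergodic commutant if for any sequence $A_k\subseteq\{1,\dots,d_k\}$ with $\liminf_{k\to\infty}u_{d_k}(A_k)>0$ and any $\varepsilon>0$ there are $r\in\mathbb N$ and $(\tau_{1,k})_k,\dots,(\tau_{r,k})_k\in\mathcal G'$ with $\liminf_{k\to\infty}u_{d_k}(\bigcup_{j=1}^r\tau_{j,k}(A_k))\ge1-\varepsilon$. $X^d$ is identified with maps $\{1,\dots,d\}\to X$; $\rho_2(\phi,\psi)=(\frac1d\sum_j\rho(\phi(j),\psi(j))^2)^{1/2}$ and $\rho_2(\phi,B)=\inf_{\psi\in B}\rho_2(\phi,\psi)$. For $\nu\in\mathrm{Prob}(X^{d})$, $\nu_j\in\mathrm{Prob}(X)$ is its $j$-th marginal. $(\mu_k)_k\in\prod_k\mathrm{Prob}(X^{d_k})$ is asymptotically supported on topological microstates if for all $g\in G$, $\delta>0$ and every neighborhood $U$ of the diagonal in $X\times X$, $\lim_{k\to\infty}\mu_k(\{\phi:u_{d_k}(\{j:(\phi(\sigma_k(g)(j)),g\phi(j))\in U\})\ge1-\delta\})=1$. $\mu_k$ locally weak$^*$-converges to $\mu\in\mathrm{Prob}(X)$ as $k\to\infty$ if $\lim_{k\to\infty}u_{d_k}(\{j:\mu_{k,j}\in\mathcal O\})=1$ for every weak$^*$ neighborhood $\mathcal O$ of $\mu$. A sequence $(\phi_k)_k\in\prod_kX^{d_k}$ is a sequence of topological microstates if $\lim_{k\to\infty}u_{d_k}(\{j:(g\phi_k(j),\phi_k(\sigma_k(g)(j)))\in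 U\})=1$ for every $g\in G$ and every neighborhood $U$ of the diagonal. *)

(* Defs.v *)
From HB Require Import structures.
From mathcomp Require Export all_boot all_order all_algebra perm.
From mathcomp Require Export all_classical all_reals all_analysis.
Export numFieldNormedType.Exports.

Set Implicit Arguments.
Unset Strict Implicit.
Unset Printing Implicit Defensive.

Import Order.TTheory GRing.Theory Num.Theory.
Local Open Scope classical_set_scope.
Local Open Scope ring_scope.

(* The multiplicative, possibly non-abelian, counterpart of the library's
   TopologicalZmodule. The chosen point is only there because
   g_sigma_algebraType requires a pointedType; it need not be 1. *)
HB.mixin Record isTopologicalGroup X & Topological X & monoid.Group X := {
  tmulg_continuous : continuous (fun xy : X * X => (xy.1 * xy.2)%g) ;
  tinvg_continuous : continuous (fun x : X => (x^-1)%g)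
}.

#[short(type="topologicalGroupType")]
HB.structure Definition TopologicalGroup :=
  {X of PointedTopological X & monoid.Group X & isTopologicalGroup X}.

Notation borel T := (g_sigma_algebraType (@open T)).

Notation "X ^^ n" := {ptws 'I_n -> X} (at level 30, right associativity)
  : type_scope.

Section Marginal.
Context (R : realType) (X : ptopologicalType) (n : nat).

Definition coord (j : 'I_n) (phi : borel (X ^^ n)) : borel X := phi j.

Lemma measurable_coord j : measurable_fun [set: borel (X ^^ n)] (coord j).
Proof.
apply: (@measurability _ _ _ (borel X) _ _ (@open X)); first by [].
move=> _ [B oB <-]; rewrite setTI; apply: sub_sigma_algebra.
apply: (iffLR (@continuousP (X ^^ n) X (@proj _ _ j))) => //.
exact: proj_continuous.
Qed.

HB.instance Definition _ (j : 'I_n) :=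
  isMeasurableFun.Build _ _ _ _ (coord j) (measurable_coord j).

Definition marginal (mu : probability (borel (X ^^ n)) R) (j : 'I_n) :
  probability (borel X) R := distribution mu (coord j).

End Marginal.

Section UniformMeasure.
Variable R : realType.

(* The value at n = 0 is 0, by the convention 0^-1 = 0. *)
Definition unif n (A : set 'I_n) : R := #|[pred j | j \in A]|%:R / n%:R.

Definition dHamm n (p q : 'S_n) : R := unif [set j | p j != q j].

End UniformMeasure.

Section Sofic.
Context (R : realType) (G : groupType) (d : nat -> nat).
Variable sigma : forall k, G -> 'S_(d k).

(* MathComp composes permutations from left to right, (s * t) j = t (s j), so
   the composite sigma_k(g) o sigma_k(h) is (sigma k h * sigma k g)%g. *)
Record sofic_approximation : Prop := SoficApproximation {
  sofic_dim : d @ \oo --> \oo ;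
  sofic_mul : forall g h,
    dHamm R (sigma k (g * h)%g) (sigma k h * sigma k g)%g @[k --> \oo]
      --> (0 : R) ;
  sofic_free : forall g h, g <> h ->
    dHamm R (sigma k g) (sigma k h) @[k --> \oo] --> (1 : R)
}.

Definition commutant : set (forall k, 'S_(d k)) :=
  [set tau | forall g,
    dHamm R (tau k * sigma k g)%g (sigma k g * tau k)%g @[k --> \oo]
      --> (0 : R)].

Definition ergodic_commutant : Prop :=
  forall (A : forall k, set 'I_(d k)) (eps : R),
    0 < limn_inf (fun k => unif R (A k)) -> 0 < eps ->
  exists (r : nat) (tau : 'I_r -> forall k, 'S_(d k)),
    (forall i, commutant (tau i)) /\
    1 - eps <= limn_inf (fun k =>
      unif R (\bigcup_(i in [set: 'I_r]) (tau i k @` A k))).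

End Sofic.

Record algebraic_action (G : groupType) (X : topologicalGroupType)
    (act : G -> X -> X) : Prop := AlgebraicAction {
  alg_act1 : forall x, act 1%g x = x ;
  alg_actM : forall g h x, act (g * h)%g x = act g (act h x) ;
  alg_act_continuous : forall g, continuous (act g) ;
  alg_act_morph : forall g x y, act g (x * y)%g = (act g x * act g y)%g
}.

Record closed_invariant_subgroup (G : groupType) (X : topologicalGroupType)
    (act : G -> X -> X) (Y : set X) : Prop := ClosedInvariantSubgroup {
  cis_closed : closed Y ;
  cis_1 : Y 1%g ;
  cis_mul : forall x y, Y x -> Y y -> Y (x * y)%g ;
  cis_inv : forall x, Y x -> Y (x^-1)%g ;
  cis_invariant : forall g, act g @` Y `<=` Y
}.

Record compatible_metric (R : realType) (X : topologicalType)
    (rho : X -> X -> R) : Prop := CompatibleMetric {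
  cmetric_ge0 : forall x y, 0 <= rho x y ;
  cmetric_eq0 : forall x y, rho x y = 0 <-> x = y ;
  cmetric_sym : forall x y, rho x y = rho y x ;
  cmetric_triangle : forall x y z, rho x z <= rho x y + rho y z ;
  cmetric_nbhs : forall x (A : set X),
    nbhs x A <-> exists2 e : R, 0 < e & [set y | rho x y < e] `<=` A
}.

(* On a compact group, invariance under left translations singles out the Haar
   probability measure. *)
Definition is_haar (R : realType) (X : topologicalGroupType)
    (m : probability (borel X) R) : Prop :=
  forall (x : X) (A : set (borel X)), measurable A ->
    m [set (x * y)%g | y in A] = m A.

(* The sets {nu | |\int f_i dnu - \int f_i dmu| < e for all i < n}, for finitely
   many continuous f_i and e > 0, form a basis of weak* neighborhoods of mu;
   on a compact space all continuous functions are bounded. *)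
Definition weak_star_nbhs (R : realType) (X : ptopologicalType)
    (mu : probability (borel X) R) (O : set (probability (borel X) R)) : Prop :=
  exists (n : nat) (f : 'I_n -> X -> R) (e : R),
    [/\ 0 < e, forall i, continuous (f i) &
        [set nu : probability (borel X) R | forall i,
          `| \int[nu]_x f i x - \int[mu]_x f i x | < e ] `<=` O].

Definition diag_nbhs (X : topologicalType) (U : set (X * X)) : Prop :=
  forall x : X, nbhs (x, x) U.

Section Rho2.
Context (R : realType) (X : ptopologicalType) (rho : X -> X -> R) (n : nat).

Definition rho2 (phi psi : X ^^ n) : R :=
  Num.sqrt (n%:R^-1 * \sum_(j < n) rho (phi j) (psi j) ^+ 2).

Definition rho2_set (phi : X ^^ n) (B : set (X ^^ n)) : R :=
  inf [set rho2 phi psi | psi in B].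

End Rho2.

Definition set_power (X : ptopologicalType) (Y : set X) n : set (X ^^ n) :=
  [set psi | forall j, Y (psi j)].

Section Microstates.
Context (R : realType) (G : groupType) (X : ptopologicalType).
Variables (act : G -> X -> X) (d : nat -> nat).
Variable sigma : forall k, G -> 'S_(d k).

Definition topological_microstates (phi : forall k, X ^^ (d k)) : Prop :=
  forall g (U : set (X * X)), diag_nbhs U ->
    unif R [set j | U (act g (phi k j), phi k (sigma k g j))] @[k --> \oo]
      --> (1 : R).

(* U ranges over the open neighborhoods of the diagonal, for which the set
   being measured is open, hence Borel; an arbitrary neighborhood contains an
   open one and the condition is monotone in U. *)
Definition asymptotically_supported
    (mu : forall k, probability (borel (X ^^ (d k))) R) : Prop :=
  forall g (delta : R) (U : set (X * X)),
    0 < delta -> open U -> diag_nbhs U ->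
    mu k [set phi : X ^^ (d k) | 1 - delta <=
            unif R [set j | U (phi (sigma k g j), act g (phi j))]] @[k --> \oo]
      --> 1%E.

Definition locally_weak_star_cvg
    (mu : forall k, probability (borel (X ^^ (d k))) R)
    (m : probability (borel X) R) : Prop :=
  forall O : set (probability (borel X) R), weak_star_nbhs m O ->
    unif R [set j | O (marginal (mu k) j)] @[k --> \oo] --> (1 : R).

End Microstates.

(* Main.v *)
Require Import Defs.
From mathcomp Require Import ring lra measurable_realfun.

(* Pointwise products, inverses and precompositions with the commutant preserve
   microstates, and the ergodic commutant spreads any positive-density set of
   vertices over almost all of them.  Call x charged if some microstate spends a
   positive density of time near x.

   If, up to passing to subsets of indices k, some x is not charged, then the
   index sets on which x is charged form a proper ideal; an ultrafilter F dual to
   it defines the set Y of points charged along F.  The operations above make Y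
   a closed invariant subgroup, proper because it misses x, and compactness shows
   that every microstate is F-asymptotically Y-valued, hence so along a
   subsequence.

   If every x is charged, finitely many microstates have values that are e-dense
   in X at almost every vertex.  Averaging over long random words in them contracts
   the oscillation of continuous functions at an explicit rate, uniformly in the
   vertex, so the uniform measures on these words, diagonalised over e, converge
   locally to Haar measure.

   Conversely, a sequence of measures converging locally to Haar measure gives
   positive mass to microstates whose mean distance to a given proper closed
   subgroup is bounded below. *)

Set Implicit Arguments.
Unset Strict Implicit.
Unset Printing Implicit Defensive.

Import Order.TTheory GRing.Theory Num.Theory.
Local Open Scope classical_set_scope.
Local Open Scope ring_scope.

(** * Uniform measure and filters *)

Section Unif.
Context {R : realType}.
Implicit Types n : nat.

Lemma unifE n (A : set 'I_n) : unif R A = n%:R^-1 * \sum_(j < n) (j \in A)%:R.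
Proof.
by rewrite /unif mulrC -sum1_card big_mkcond natr_sum.
Qed.

Lemma unif_ge0 n (A : set 'I_n) : 0 <= unif R A.
Proof. by rewrite mulr_ge0 ?invr_ge0. Qed.

Lemma le_unif n (A B : set 'I_n) : A `<=` B -> unif R A <= unif R B.
Proof.
move=> AB; rewrite !unifE ler_wpM2l ?invr_ge0 // ler_sum // => j _.
rewrite ler_nat; case: (boolP (j \in A)) => // /set_mem /AB jB.
by rewrite (mem_set jB).
Qed.

Lemma unif_set0 n : unif R (@set0 'I_n) = 0.
Proof. by rewrite unifE big1 ?mulr0 // => j _; rewrite in_set0. Qed.

Lemma unif_setT n : (0 < n)%N -> unif R [set: 'I_n] = 1.
Proof.
move=> n0; rewrite unifE (eq_bigr (fun=> 1)) => [|j _]; last by rewrite in_setT.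
by rewrite sumr_const card_ord mulVf // pnatr_eq0 -lt0n.
Qed.

Lemma unif_setC n (A : set 'I_n) : (0 < n)%N -> unif R (~` A) = 1 - unif R A.
Proof.
move=> n0; rewrite -(unif_setT n0) !unifE -mulrBr -sumrB; congr (_ * _).
by apply: eq_bigr => j _; rewrite in_setC in_setT; case: (j \in A); rewrite ?subrr ?subr0.
Qed.

Lemma unif_setU n (A B : set 'I_n) : unif R (A `|` B) <= unif R A + unif R B.
Proof.
rewrite !unifE -mulrDr -big_split /= ler_wpM2l ?invr_ge0 // ler_sum // => j _.
by rewrite in_setU -natrD ler_nat; case: (j \in A); case: (j \in B).
Qed.

Lemma unif_le1 n (A : set 'I_n) : unif R A <= 1.
Proof.
case: n A => [|n] A; first by rewrite /unif invr0 mulr0.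
by rewrite -(@unif_setT n.+1) // le_unif.
Qed.

Lemma unif_perm n (s : 'S_n) (A : set 'I_n) : unif R [set j | A (s j)] = unif R A.
Proof.
rewrite !unifE; congr (_ * _); rewrite [RHS](reindex_inj (@perm_inj _ s)) /=.
by apply: eq_bigr => j _; congr (_%:R); apply: congr1; apply/idP/idP => /set_mem/mem_set.
Qed.

Lemma unif_bigcup n r (A : 'I_r -> set 'I_n) :
  unif R (\bigcup_(i in [set: 'I_r]) A i) <= \sum_i unif R (A i).
Proof.
elim: r A => [|r IH] A.
  rewrite big_ord0 (_ : \bigcup_(_ in _) _ = set0) ?unif_set0 //.
  by apply/seteqP; split => // x [[]].
rewrite big_ord_recl; apply: le_trans (lerD (lexx _) (IH _)).
apply: le_trans (unif_setU _ _); apply: le_unif => j [i _ Aij].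
case: (unliftP ord0 i) Aij => [i' ->|->] Aij; last by left.
by right; exists i'.
Qed.

(** Passing to complements turns convergence to 1 into smallness, which adds up under unions.
    Positivity of [d k] enters because [unif] vanishes identically in dimension 0. *)
Lemma cvg_unif1 (d : nat -> nat) (A : forall k, set 'I_(d k)) :
  (\forall k \near \oo, (0 < d k)%N) ->
  (unif R (A k) @[k --> \oo] --> (1 : R)) <->
  (forall e : R, 0 < e -> \forall k \near \oo, unif R (~` A k) < e).
Proof.
move=> d0; split => [/cvgrPdist_lt h e /h | h].
  apply: filterS2 d0 => k dk; rewrite unif_setC //.
  by rewrite ger0_norm // subr_ge0 unif_le1.
apply/cvgrPdist_lt => e /h; apply: filterS2 d0 => k dk; rewrite unif_setC //.
by rewrite ger0_norm // subr_ge0 unif_le1.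
Qed.

Lemma unif_le_setD n (A B C : set 'I_n) :
  A `<=` B `|` C -> unif R A <= unif R B + unif R C.
Proof. by move=> /le_unif h; apply: le_trans h (unif_setU _ _). Qed.

(** [B] outweighs the part missed by the [A i] by [c], so it meets their union in density at least
    [c]. Dividing by [r.+1] keeps a sum of [r] smaller terms strictly below [c], also for
    [r = 0]. *)
Lemma unif_meet n r (B : set 'I_n) (A : 'I_r -> set 'I_n) (c : R) :
  unif R (~` \bigcup_(i in [set: 'I_r]) A i) + c <= unif R B -> 0 < c ->
  exists i, c / r.+1%:R <= unif R (B `&` A i).
Proof.
move=> Bc c0; apply: contrapT => /forallNP h.
suff : unif R B < unif R (~` \bigcup_(i in [set: 'I_r]) A i) + c.
  by rewrite ltNge Bc.
apply: (@le_lt_trans _ _ (unif R (~` \bigcup_(i in [set: 'I_r]) A i) +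
  unif R (\bigcup_(i in [set: 'I_r]) (B `&` A i)))).
  apply: unif_le_setD => j Bj; case: (pselect ((\bigcup_(i in [set: 'I_r]) A i) j)).
    by move=> [i _ Aij]; right; exists i.
  by left.
rewrite ltrD2l; apply: le_lt_trans (unif_bigcup _) _.
apply: (@le_lt_trans _ _ (\sum_(i < r) (c / r.+1%:R))).
  by apply: ler_sum => i _; apply/ltW; rewrite ltNge; apply/negP/h.
rewrite sumr_const card_ord -[_ *+ r]mulr_natr -mulrA gtr_pMr //.
by rewrite mulrC ltr_pdivrMr // mul1r ltr_nat.
Qed.

End Unif.

Section Filters.

(** Otherwise [F] contains every complement, hence their finite intersection, which is disjoint from
    the union. *)
Lemma ultra_pigeonhole (F : set_system nat) (I : finType) (P : I -> set nat) :
  UltraFilter F -> F [set k | exists i, P i k] -> exists i, F (P i).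
Proof.
move=> uF h; apply: contrapT => /forallNP hP.
have : \forall k \near F, forall i, ~ P i k.
  by apply: filter_forall => i; case: (in_ultra_setVsetC (P i) uF) => // /hP.
by move=> /(filterI h) /filter_ex[k [[i Pik] /(_ i)]].
Qed.

(** Local-to-global principle replacing finite subcovers. If [Q setT] failed, the complements of
    [Q]-sets would form a proper filter, and a neighborhood in [Q] of a cluster point would
    contradict clustering. *)
Lemma compact_ideal (X : topologicalType) (Q : set X -> Prop) :
  compact [set: X] -> Q set0 ->
  (forall A B, B `<=` A -> Q A -> Q B) ->
  (forall A B, Q A -> Q B -> Q (A `|` B)) ->
  (forall x : X, exists2 A : set X, nbhs x A & Q A) -> Q setT.
Proof.
move=> cX Q0 QS QU Qx; apply: contrapT => nQT.
pose F : set_system X := [set A | Q (~` A)].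
have FF : ProperFilter F.
  split; first by rewrite /F /= setC0.
  split; rewrite /F /=.
  - by rewrite setCT.
  - by move=> A B QA QB; rewrite /F /= setCI; apply: QU.
  - by move=> A B AB; apply: QS; apply: subsetC.
have [x [_ xF]] := cX F FF (@filterT _ F _).
have [A xA QA] := Qx x.
have FA : F (~` A) by rewrite /F /= setCK.
by have [y []] := xF _ _ FA xA.
Qed.

End Filters.

(** * Compatible metrics *)

Section LimnInf.
Context {R : realType}.
Implicit Types u : nat -> R.

Let bounded01 u : (forall k, 0 <= u k <= 1) -> bounded_fun u.
Proof.
move=> u01; exists 1; split; first exact: num_real.
move=> x x1 k _ /=; have /andP[u0 u1] := u01 k.
by rewrite ger0_norm // (le_trans u1) // ltW.
Qed.

Lemma limn_inf_ge u c : (forall k, 0 <= u k <= 1) ->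
  (\forall k \near \oo, c <= u k) -> c <= limn_inf u.
Proof.
move=> u01 [N _ h]; rewrite limn_infE; last exact: bounded01.
apply: (@le_trans _ _ (infs u N)).
  apply: lb_le_inf; first by exists (u N); exists N => /=.
  by move=> _ [k /= Nk <-]; apply: h.
apply: ub_le_sup; last by exists N.
exact/bounded_fun_has_ubound_infs/bounded01.
Qed.

Lemma lt_limn_inf u c : (forall k, 0 <= u k <= 1) ->
  c < limn_inf u -> \forall k \near \oo, c < u k.
Proof.
move=> u01; rewrite limn_infE; last exact: bounded01.
move=> /sup_gt[|_ [N _ <-] cN]; first by exists (infs u 0%N); exists 0%N.
exists N => // k /= Nk; apply: lt_le_trans cN _.
apply: ge_inf; last by exists k.
by exists 0 => _ [i _ <-]; case/andP: (u01 i).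
Qed.

End LimnInf.

Section CompatibleMetric.
Context {R : realType} {X : ptopologicalType} {rho : X -> X -> R}.
Hypothesis rhoP : compatible_metric rho.

Let rho_sym := cmetric_sym rhoP.
Let rho_tri := cmetric_triangle rhoP.

Lemma rhoxx x : rho x x = 0.
Proof. exact/(cmetric_eq0 rhoP). Qed.

Lemma near_rho x (e : R) : 0 < e -> \forall y \near x, rho x y < e.
Proof. by move=> e0; apply/(cmetric_nbhs rhoP); exists e. Qed.

Lemma open_rho (e : R) : open [set p : X * X | rho p.1 p.2 < e].
Proof.
rewrite openE => -[x y] /= xye; rewrite /interior /=.
pose r := (e - rho x y) / 2; have r0 : 0 < r by rewrite divr_gt0 ?subr_gt0.
exists ([set z | rho x z < r], [set z | rho y z < r]); first by split; exact: near_rho.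
move=> [a b] /= [xa yb]; have := rho_tri a x b; have := rho_tri x y b.
rewrite (rho_sym a x); rewrite /r in xa yb; lra.
Qed.

Lemma diag_nbhs_rho (e : R) : 0 < e -> diag_nbhs [set p : X * X | rho p.1 p.2 < e].
Proof.
move=> e0 x; apply: open_nbhs_nbhs; split; first exact: open_rho.
by rewrite /= rhoxx.
Qed.

Lemma lipschitz_continuous (f : X -> R) :
  (forall x y, f x - f y <= rho x y) -> continuous f.
Proof.
move=> fL x; apply/cvgrPdist_lt => e e0.
apply: filterS (near_rho x e0) => y xy; rewrite ltr_norml.
by have := fL x y; have := fL y x; rewrite (rho_sym y); lra.
Qed.

Lemma continuous_rho (f : X -> X) x (e : R) : continuous f -> 0 < e ->
  exists2 r : R, 0 < r & forall y, rho x y < r -> rho (f x) (f y) < e.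
Proof.
move=> cf e0; have := cf x _ (near_rho (f x) e0).
by move=> /(cmetric_nbhs rhoP)[r r0 hr]; exists r => // y; exact: hr.
Qed.

Hypothesis X_compact : compact [set: X].

(** A box around [(x, x)] inside [U] contains the square of a ball of radius [r]; halving [r] keeps
    both [a] and [b] in that ball. Compactness makes the radius uniform. *)
Lemma lebesgue_number (U : set (X * X)) : diag_nbhs U ->
  exists2 e : R, 0 < e & forall a b, rho a b < e -> U (a, b).
Proof.
move=> dU; pose Q (A : set X) :=
  exists2 e : R, 0 < e & forall a b, A a -> rho a b < e -> U (a, b).
suff [e e0 h] : Q setT by exists e => // a b; apply: h.
apply: compact_ideal => //.
- by exists 1.
- by move=> A B BA [e e0 h]; exists e => // a b /BA; apply: h.
- move=> A B [e e0 h] [e' e'0 h']; exists (Num.min e e'); first by rewrite lt_min e0.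
  by move=> a b; rewrite lt_min => -[/h + | /h' +] /andP[ee ee']; apply.
move=> x; have [[A B] [/= xA xB] AB] := dU x.
have /(cmetric_nbhs rhoP) [r r0 rAB] : nbhs x (A `&` B) by exact: filterI.
exists [set y | rho x y < r / 2]; first by apply: near_rho; rewrite divr_gt0.
exists (r / 2); first by rewrite divr_gt0.
move=> a b /= xa ab; apply: AB; split => /=.
  by apply: (rAB a _).1 => /=; lra.
by apply: (rAB b _).2 => /=; have := rho_tri x a b; lra.
Qed.

Lemma rho_bounded : exists2 M : R, 0 < M & forall x y, rho x y <= M.
Proof.
pose Q (A : set X) := exists M : R, forall a, A a -> rho point a <= M.
have [M h] : Q setT.
  apply: compact_ideal => //.
  - by exists 0.
  - by move=> A B BA [M h]; exists M => a /BA; apply: h.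
  - move=> A B [M h] [M' h']; exists (Num.max M M') => a.
    by rewrite le_max => -[/h -> | /h' ->] //; rewrite orbT.
  move=> x; exists [set y | rho x y < 1]; first exact: near_rho.
  by exists (rho point x + 1) => a /= xa; have := rho_tri point x a; lra.
exists (M + M + 1).
  by have := cmetric_ge0 rhoP point point; have := h point I; lra.
move=> x y; have := rho_tri x point y; have := h x I; have := h y I.
by rewrite (rho_sym x point); lra.
Qed.

Lemma continuous_bounded (f : X -> R) : continuous f ->
  exists2 M : R, 0 < M & forall x, `|f x| <= M.
Proof.
move=> cf; pose Q (A : set X) := exists M : R, forall a, A a -> `|f a| <= M.
have [M h] : Q setT.
  apply: compact_ideal => //.
  - by exists 0.
  - by move=> A B BA [M h]; exists M => a /BA; apply: h.
  - move=> A B [M h] [M' h']; exists (Num.max M M') => a.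
    by rewrite le_max => -[/h -> | /h' ->] //; rewrite orbT.
  move=> x; exists [set y | `|f x - f y| < 1].
    by have /cvgrPdist_lt := cf x; apply.
  exists (`|f x| + 1) => a /= xa.
  by have := ler_normB (f x) (f x - f a); rewrite subKr; lra.
exists (M + 1) => [|x]; last by have := h x I; lra.
by have := h point I; have := normr_ge0 (f point); lra.
Qed.

Lemma continuous_pos (f : X -> R) : continuous f -> (forall x, 0 < f x) ->
  exists2 c : R, 0 < c & forall x, c <= f x.
Proof.
move=> cf f0; pose Q (A : set X) := exists2 c : R, 0 < c & forall a, A a -> c <= f a.
have [c c0 h] : Q setT; last by exists c => // x; apply: h.
apply: compact_ideal => //.
- by exists 1.
- by move=> A B BA [c c0 h]; exists c => // a /BA; apply: h.
- move=> A B [c c0 h] [c' c'0 h']; exists (Num.min c c'); first by rewrite lt_min c0.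
  by move=> a; rewrite ge_min => -[/h -> | /h' ->] //; rewrite orbT.
move=> x; exists [set y | `|f x - f y| < f x / 2].
  by have /cvgrPdist_lt := cf x; apply; rewrite divr_gt0.
exists (f x / 2); first by rewrite divr_gt0.
by move=> a /=; rewrite ltr_norml; lra.
Qed.

Definition dist_to (Y : set X) (x : X) : R := inf [set rho x y | y in Y].

Section DistTo.
Variable Y : set X.
Hypothesis Y0 : Y !=set0.

Let has_inf_dist x : has_inf [set rho x y | y in Y].
Proof.
split; first by case: Y0 => y Yy; exists (rho x y); exists y.
by exists 0 => _ [y _ <-]; exact: cmetric_ge0.
Qed.

Lemma dist_to_ge0 x : 0 <= dist_to Y x.
Proof.
apply: lb_le_inf; first by case: (has_inf_dist x).
by move=> _ [y _ <-]; exact: cmetric_ge0.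
Qed.

Lemma dist_to_le x y : Y y -> dist_to Y x <= rho x y.
Proof. by move=> Yy; apply: ge_inf; [case: (has_inf_dist x) | exists y]. Qed.

Lemma dist_to_lt x (e : R) : dist_to Y x < e -> exists2 y, Y y & rho x y < e.
Proof.
move=> /inf_lt[|_ [y Yy <-] h]; first by case: (has_inf_dist x).
by exists y.
Qed.

Lemma continuous_dist_to : continuous (dist_to Y).
Proof.
apply: lipschitz_continuous => x y; rewrite lerBlDr -lerBlDl.
apply: lb_le_inf; first by case: (has_inf_dist y).
move=> _ [z Yz <-]; have := dist_to_le x Yz; have := rho_tri x y z; lra.
Qed.

Lemma dist_to_gt0 x : closed Y -> ~ Y x -> 0 < dist_to Y x.
Proof.
move=> cY nYx; rewrite lt_def dist_to_ge0 andbT; apply/eqP => d0.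
apply/nYx/cY => B /(cmetric_nbhs rhoP)[e e0 eB].
have [|y Yy xy] := @dist_to_lt x e; first by rewrite d0.
by exists y; split => //; apply: eB.
Qed.

End DistTo.

End CompatibleMetric.

Arguments dist_to {R X} rho Y x.

(** The pairs that are good for all [t] at once form a neighborhood of the diagonal, by the tube
    lemma over the compact [T]; a Lebesgue number of this set is the desired [e]. *)
Lemma compact_equicontinuous (R : realType) (T Z : topologicalType)
    (X : ptopologicalType) (rho : X -> X -> R) (H : T * X -> Z) (U : set (Z * Z)) :
  compatible_metric rho -> compact [set: X] -> compact [set: T] ->
  continuous H -> diag_nbhs U ->
  exists2 e : R, 0 < e & forall t a b, rho a b < e -> U (H (t, a), H (t, b)).
Proof.
move=> rhoP cX cT cH dU.
have [x|e e0 h] := @lebesgue_number _ _ _ rhoP cX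
  [set p | forall t, U (H (t, p.1), H (t, p.2))]; last first.
  by exists e => // t a b /h; apply.
have /compact_near_coveringP nc := cT.
apply: filterS (nc (X * X)%type (nbhs (x, x))
  (fun p t => U (H (t, p.1), H (t, p.2))) _ _).
  by move=> p /= h t; exact: h.
move=> t _; rewrite /prop_near2 /=.
  have c1 : (H (q.1, q.2.1), H (q.1, q.2.2)) @[q --> (t, (x, x))] --> (H (t, x), H (t, x)).
    apply: cvg_pair => /=.
      apply: (@cvg_comp _ _ _ (fun q : T * (X * X) => (q.1, q.2.1)) H); last exact: cH.
      apply: cvg_pair => /=; first exact: cvg_fst.
      by apply: (cvg_comp _ _ cvg_snd); exact: cvg_fst.
    apply: (@cvg_comp _ _ _ (fun q : T * (X * X) => (q.1, q.2.2)) H); last exact: cH.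
    apply: cvg_pair => /=; first exact: cvg_fst.
    by apply: (cvg_comp _ _ cvg_snd); exact: cvg_snd.
  exact: (c1 _ (dU _)).
Qed.

Lemma continuous_pair (T U V : topologicalType) (f : T -> U) (g : T -> V) :
  continuous f -> continuous g -> continuous (fun t => (f t, g t)).
Proof.
move=> cf cg t; have c : (f s, g s) @[s --> t] --> (f t, g t).
  by apply: cvg_pair; [exact: cf | exact: cg].
exact: c.
Qed.

Lemma continuous_mulg (X : topologicalGroupType) (T : topologicalType) (f g : T -> X) :
  continuous f -> continuous g -> continuous (fun t => (f t * g t)%g).
Proof.
move=> cf cg t.
exact: (cvg_comp _ _ (continuous_pair cf cg (x := t)) (@tmulg_continuous X (f t, g t))).
Qed.

Section TopGroup.
Context {R : realType} {X : topologicalGroupType} {rho : X -> X -> R}.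
Hypothesis rhoP : compatible_metric rho.
Hypothesis X_compact : compact [set: X].

Lemma rho_mulg_uniform (e : R) : 0 < e -> exists2 r : R, 0 < r &
  forall a a' b b', rho a a' < r -> rho b b' < r -> rho (a * b)%g (a' * b')%g < e.
Proof.
move=> e0; have e20 : 0 < e / 2 by rewrite divr_gt0.
have [r r0 hr] := @compact_equicontinuous R X X X rho _ _ rhoP X_compact X_compact
  (@tmulg_continuous X) (diag_nbhs_rho rhoP e20).
have [|r' r'0 hr'] := @compact_equicontinuous R X X X rho
    (fun p => p.2 * p.1)%g _ rhoP X_compact X_compact _ (diag_nbhs_rho rhoP e20).
  by apply: continuous_mulg => -[a b]; [exact: cvg_snd | exact: cvg_fst].
exists (Num.min r r') => [|a a' b b']; first by rewrite lt_min r0.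
rewrite !lt_min => /andP[_ /(hr' b) /= h1] /andP[/(hr a') /= h2 _].
have := cmetric_triangle rhoP (a * b)%g (a' * b)%g (a' * b')%g; lra.
Qed.

(** Compactness of [X * X], the space of pairs [(s, t)], gives uniformity in both translations, as
    [modulus] requires. *)
Lemma mulg_equicontinuous (f : X -> R) (e : R) : continuous f -> 0 < e ->
  exists2 r : R, 0 < r & forall s t a b, rho a b < r ->
    `|f (s * a * t)%g - f (s * b * t)%g| < e.
Proof.
move=> cf e0.
pose H (p : (X * X) * X) := f (p.1.1 * p.2 * p.1.2)%g.
have cXX : compact [set: X * X] by rewrite -setXTT; exact: compact_setX.
have cH : continuous H.
  have cfst : continuous (fun p : (X * X) * X => p.1) by move=> [p a]; exact: cvg_fst.
  have cG : continuous (fun p : (X * X) * X => p.1.1 * p.2 * p.1.2)%g.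
    apply: continuous_mulg; first apply: continuous_mulg.
    - move=> [[s t] a]; apply: (cvg_comp _ _ (cfst _)); exact: cvg_fst.
    - by move=> [p a]; exact: cvg_snd.
    - move=> [[s t] a]; apply: (cvg_comp _ _ (cfst _)); exact: cvg_snd.
  by move=> p; apply: (cvg_comp _ _ (cG p)); exact: cf.
have dU : diag_nbhs [set p : R * R | `|p.1 - p.2| < e].
  move=> x; have e20 : 0 < e / 2 by rewrite divr_gt0.
  exists (ball x (e / 2), ball x (e / 2)).
    by split; apply: nbhsx_ballx.
  move=> [a b] /= []; rewrite /ball /= => xa xb.
  have -> : a - b = (x - b) - (x - a) by ring.
  by have := ler_normB (x - b) (x - a); lra.
have [r r0 h] := compact_equicontinuous rhoP X_compact cXX cH dU.
by exists r => // s t a b /(h (s, t)).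
Qed.

End TopGroup.

(** * Microstates *)

Section AlgebraicAction.
Context {G : groupType} {X : topologicalGroupType} {act : G -> X -> X}.
Hypothesis actP : algebraic_action act.

Lemma act1g g : act g 1%g = 1%g.
Proof. by apply: (@mulgI _ (act g 1%g)); rewrite -(alg_act_morph actP) !mulg1. Qed.

Lemma actVg g x : act g (x^-1)%g = ((act g x)^-1)%g.
Proof.
by apply: (@mulgI _ (act g x)); rewrite -(alg_act_morph actP) !mulgV act1g.
Qed.

End AlgebraicAction.

Section Microstates.
Context {R : realType} {G : groupType} {d : nat -> nat}.
Context {sigma : forall k, G -> 'S_(d k)}.
Hypothesis sigmaP : sofic_approximation R sigma.
Context {X : topologicalGroupType} {act : G -> X -> X} {rho : X -> X -> R}.
Hypothesis X_compact : compact [set: X].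
Hypothesis rhoP : compatible_metric rho.

Local Notation microstates := (@topological_microstates R G X act d sigma).

Lemma dim_gt0 : \forall k \near \oo, (0 < d k)%N.
Proof. by apply: (sofic_dim sigmaP (t := [set n | (0 < n)%N])); exists 1%N. Qed.

Definition defect k (g : G) (e : R) (phi : X ^^ (d k)) : set 'I_(d k) :=
  [set j | e <= rho (act g (phi j)) (phi (sigma k g j))].

(** Sets of large metric defect replace arbitrary neighborhoods of the diagonal; a Lebesgue number
    gives the way back. *)
Lemma microstatesP (phi : forall k, X ^^ (d k)) : microstates phi <->
  forall g (e : R), 0 < e -> forall r : R, 0 < r ->
    \forall k \near \oo, unif R (defect g e (phi k)) < r.
Proof.
split=> [phiP g e e0 | h g U /(lebesgue_number rhoP X_compact)[e e0 eU]].
  have := phiP g _ (diag_nbhs_rho rhoP e0) => /(cvg_unif1 _ dim_gt0) h r /h.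
  apply: filterS => k; apply: le_lt_trans; apply: le_unif => j /= ej.
  by apply/negP; rewrite -leNgt.
apply/(cvg_unif1 _ dim_gt0) => r r0; have := h g e e0 r r0.
apply: filterS => k; apply: le_lt_trans; apply: le_unif => j /= nU.
by rewrite /defect /= leNgt; apply/negP => /eU.
Qed.

Hypothesis actP : algebraic_action act.

Lemma microstates1 : microstates (fun k _ => 1%g).
Proof.
apply/microstatesP => g e e0 r r0; apply: nearW => k.
rewrite (_ : defect _ _ _ = set0) ?unif_set0 //.
apply/seteqP; split => // j; rewrite /defect /= (act1g actP) (rhoxx rhoP).
by rewrite leNgt e0.
Qed.

(** Inversion commutes with the action and pulls neighborhoods of the diagonal back to neighborhoods
    of the diagonal. *)
Lemma microstates_inv (phi : forall k, X ^^ (d k)) :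
  microstates phi -> microstates (fun k j => (phi k j)^-1)%g.
Proof.
move=> phiP g U dU.
have := phiP g [set p | U (p.1^-1, p.2^-1)%g] _.
rewrite (_ : (fun k => _) = fun k => unif R
  [set j | U (act g (phi k j)^-1, (phi k (sigma k g j))^-1)%g]); last first.
  by apply/funext => k; congr unif; apply/funext => j /=; rewrite (actVg actP).
apply=> x.
have c : (p.1^-1, p.2^-1)%g @[p --> (x, x)] --> (x^-1, x^-1)%g.
  apply: cvg_pair.
    by apply: (cvg_comp _ _ cvg_fst); exact: tinvg_continuous.
  by apply: (cvg_comp _ _ cvg_snd); exact: tinvg_continuous.
exact: (c _ (dU _)).
Qed.

(** By uniform continuity of multiplication, a defect of the product forces a defect of one factor,
    at a smaller scale. *)
Lemma microstates_mul (phi psi : forall k, X ^^ (d k)) :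
  microstates phi -> microstates psi -> microstates (fun k j => phi k j * psi k j)%g.
Proof.
move=> /microstatesP phiP /microstatesP psiP; apply/microstatesP => g e e0 r r0.
have [s s0 hs] := rho_mulg_uniform rhoP X_compact e0.
have r20 : 0 < r / 2 by rewrite divr_gt0.
apply: filterS2 (phiP g s s0 _ r20) (psiP g s s0 _ r20) => k h1 h2; have := unif_le_setD
  (A := defect g e (fun j => phi k j * psi k j)%g)
  (B := defect g s (phi k)) (C := defect g s (psi k)) => /(_ R) h.
apply: (@le_lt_trans _ _ _ _ _ (h _)); last lra.
move=> j; rewrite /defect /= => hj.
case: (lerP s (rho (act g (phi k j)) (phi k (sigma k g j)))); first by left.
case: (lerP s (rho (act g (psi k j)) (psi k (sigma k g j)))); first by right.
move=> /(hs _ _ _ _ _) h' /h'; rewrite -(alg_act_morph actP) => /lt_geF.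
by rewrite hj.
Qed.

(** At the vertex [tau k j], either [tau k] and [sigma k g] fail to commute at [j], which is rare,
    or the defect is one of [phi k] at [j]. *)
Lemma microstates_perm (phi : forall k, X ^^ (d k)) (tau : forall k, 'S_(d k)) :
  commutant R sigma tau -> microstates phi ->
  microstates (fun k j => phi k ((tau k)^-1%g j)).
Proof.
move=> tauP /microstatesP phiP; apply/microstatesP => g e e0 r r0.
have r20 : 0 < r / 2 by rewrite divr_gt0.
have /cvgrPdist_lt /(_ _ r20) := tauP g.
apply: filterS2 (phiP g e e0 _ r20) => k h1; rewrite sub0r normrN.
rewrite ger0_norm; last exact: unif_ge0.
rewrite /dHamm => h2; rewrite -(unif_perm (tau k)).
have -> : r = r / 2 + r / 2 by lra.
apply: le_lt_trans (ltrD h1 h2); apply: unif_le_setD => j.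
rewrite /defect /= permK !permM; case: eqP => [->|]; last by right.
by rewrite permK; left.
Qed.

Lemma microstates_glue (S : set nat) (phi psi : forall k, X ^^ (d k)) :
  microstates phi -> microstates psi ->
  microstates (fun k => if k \in S then phi k else psi k).
Proof.
move=> /microstatesP phiP /microstatesP psiP; apply/microstatesP => g e e0 r r0.
apply: filterS2 (phiP g e e0 _ r0) (psiP g e e0 _ r0) => k h1 h2.
by case: (k \in S).
Qed.

Hypothesis sigma_ergodic : ergodic_commutant R sigma.

(** The form in which ergodicity is used. Applying it with [e / 2] leaves room to pass from a bound
    on the lower limit to a strict eventual bound; images under [tau] become preimages under its
    inverse, to match [microstates_perm]. *)
Lemma ergodic_cover (A : forall k, set 'I_(d k)) (c e : R) : 0 < c -> 0 < e ->
  (\forall k \near \oo, c <= unif R (A k)) ->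
  exists (r : nat) (tau : 'I_r -> forall k, 'S_(d k)),
    (forall i, commutant R sigma (tau i)) /\
    \forall k \near \oo,
      unif R (~` \bigcup_(i in [set: 'I_r]) [set j | A k ((tau i k)^-1%g j)]) < e.
Proof.
move=> c0 e0 cA.
have [||r [tau [tauP h]]] := @sigma_ergodic A (e / 2); rewrite ?divr_gt0 //.
  apply: lt_le_trans c0 _; apply: limn_inf_ge => // k.
  by rewrite unif_ge0 unif_le1.
exists r, tau; split => //.
have {}h : 1 - e < limn_inf (fun k => unif R (\bigcup_(i in [set: 'I_r]) (tau i k @` A k))).
  by apply: lt_le_trans h; lra.
apply: filterS2 dim_gt0 (lt_limn_inf _ h); last first.
  by move=> k /=; rewrite unif_ge0 unif_le1.
move=> k dk hk; rewrite unif_setC // ltrBlDr addrC -ltrBlDr.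
apply: lt_le_trans hk _; apply: le_unif => j [i _ [j' Aj' <-]].
by exists i => //=; rewrite permK.
Qed.

End Microstates.

(** * The distance [rho2] to powers of a set *)

Section Rho2.
Context {R : realType} {X : ptopologicalType} {rho : X -> X -> R} {n : nat}.
Hypothesis rhoP : compatible_metric rho.
Implicit Types (phi psi : X ^^ n) (Y : set X).

(** The inequality, instead of an equality, covers [n = 0], where the left side is 0. *)
Let n1 : n%:R^-1 * \sum_(j < n) (1 : R) <= 1.
Proof.
case: n => [|m]; first by rewrite big_ord0 mulr0.
by rewrite sumr_const card_ord mulVf ?pnatr_eq0.
Qed.

Lemma mean_le_rho2 phi psi :
  n%:R^-1 * \sum_(j < n) rho (phi j) (psi j) <= rho2 rho phi psi.
Proof.
rewrite /rho2; set m := _ * _.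
have m0 : 0 <= m.
  rewrite mulr_ge0 ?invr_ge0 // sumr_ge0 // => j _; exact: cmetric_ge0.
rewrite -[leLHS]ger0_norm // -sqrtr_sqr ler_wsqrtr //.
(* the variance of the distances is nonnegative *)
have : 0 <= n%:R^-1 * \sum_(j < n) (rho (phi j) (psi j) - m) ^+ 2.
  by rewrite mulr_ge0 ?invr_ge0 // sumr_ge0 // => j _; exact: sqr_ge0.
under eq_bigr do rewrite sqrrB -mulrnAl -[_ *+ 2]mulr_natr -mulrA -[m ^+ 2]mulr1.
rewrite big_split /= sumrB -mulr_suml -mulr_sumr mulrDr mulrBr.
rewrite [X in _ - X + _]mulrA -/m [X in _ + X]mulrCA.
have := ler_wpM2l (sqr_ge0 m) n1; rewrite mulr1; nra.
Qed.

Lemma rho2_set_ge (Y : set X) phi (a : R) : Y !=set0 ->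
  a <= n%:R^-1 * \sum_(j < n) dist_to rho Y (phi j) ->
  a <= rho2_set rho phi (@set_power X Y n).
Proof.
move=> [y Yy] ha; apply: lb_le_inf; first by exists (rho2 rho phi (fun=> y)); exists (fun=> y).
move=> _ [psi Ypsi <-]; apply: le_trans (mean_le_rho2 _ _); apply: le_trans ha _.
rewrite ler_wpM2l ?invr_ge0 // ler_sum // => j _.
by apply: (dist_to_le rhoP) => //; exists y.
Qed.

Lemma rho2_set_ge0 (Y : set X) phi : Y !=set0 -> 0 <= rho2_set rho phi (@set_power X Y n).
Proof.
move=> Y0; apply: (rho2_set_ge Y0).
by rewrite mulr_ge0 ?invr_ge0 // sumr_ge0 // => j _; exact: (dist_to_ge0 rhoP).
Qed.

(** Take [psi] within [e / 2] of [phi] wherever [Y] is that close, and constant elsewhere. The close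
    vertices contribute at most [(e / 2) ^+ 2] to the mean square, the others at most [M ^+ 2] times
    their density, so the total is below [e ^+ 2 / 2]. *)
Lemma rho2_set_lt (Y : set X) phi (M e : R) : Y !=set0 -> 0 < e -> 0 < M ->
  (forall x y, rho x y <= M) ->
  unif R [set j | e / 2 <= dist_to rho Y (phi j)] < (e / (2 * M)) ^+ 2 ->
  rho2_set rho phi (@set_power X Y n) < e.
Proof.
move=> Y0 e0 M0 rhoM hu.
have [y Yy] := Y0.
have psiP (j : 'I_n) : exists z, Y z /\ (dist_to rho Y (phi j) < e / 2 -> rho (phi j) z < e / 2).
  case: (ltP (dist_to rho Y (phi j)) (e / 2)) => [/(dist_to_lt rhoP Y0)[z Yz h]|_].
    by exists z.
  by exists y.
have [psi psiH] := choice psiP.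
apply: (@le_lt_trans _ _ (rho2 rho phi psi)).
  apply: ge_inf; last by exists psi => // j; case: (psiH j).
  by exists 0 => _ [? _ <-]; exact: sqrtr_ge0.
rewrite -[ltRHS]gtr0_norm // -sqrtr_sqr ltr_sqrt ?exprn_gt0 //.
apply: (@le_lt_trans _ _ (n%:R^-1 * \sum_(j < n) ((e / 2) ^+ 2 * 1 +
   M ^+ 2 * (j \in [set j | e / 2 <= dist_to rho Y (phi j)])%:R))).
  rewrite ler_wpM2l ?invr_ge0 // ler_sum // => j _; rewrite mulr1.
  have r0 := cmetric_ge0 rhoP (phi j) (psi j).
  case: (boolP (j \in _)) => [_|/negP jn].
    have : rho (phi j) (psi j) ^+ 2 <= M ^+ 2 by rewrite ler_pXn2r ?nnegrE // ltW.
    by rewrite mulr1; have := sqr_ge0 (e / 2); lra.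
  have /ltW h : rho (phi j) (psi j) < e / 2.
    by apply: (psiH j).2; rewrite ltNge; apply/negP => h; apply/jn/mem_set.
  by rewrite mulr0 addr0 ler_pXn2r ?nnegrE // divr_ge0 // ltW.
rewrite big_split /= -!mulr_sumr mulrDr ![n%:R^-1 * (_ * _)]mulrCA -unifE.
have e2 : 0 < e ^+ 2 by rewrite exprn_gt0.
have h1 := ler_wpM2l (sqr_ge0 (e / 2)) n1.
have h2 : M ^+ 2 * unif R [set j | e / 2 <= dist_to rho Y (phi j)] < M ^+ 2 * (e / (2 * M)) ^+ 2.
  by rewrite ltr_pM2l // exprn_gt0.
have e3 : M ^+ 2 * (e / (2 * M)) ^+ 2 = e ^+ 2 / 4 by field; rewrite gt_eqF.
have e4 : (e / 2) ^+ 2 = e ^+ 2 / 4 by field.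
rewrite e3 in h2; rewrite e4 mulr1 in h1; rewrite e4; lra.
Qed.

End Rho2.

(** * Charged points *)

Section Charged.
Context {R : realType} {G : groupType} {d : nat -> nat}.
Context {sigma : forall k, G -> 'S_(d k)}.
Hypothesis sigmaP : sofic_approximation R sigma.
Hypothesis sigma_ergodic : ergodic_commutant R sigma.
Context {X : topologicalGroupType} {act : G -> X -> X} {rho : X -> X -> R}.
Hypothesis X_compact : compact [set: X].
Hypothesis rhoP : compatible_metric rho.
Hypothesis actP : algebraic_action act.

Local Notation microstates := (@topological_microstates R G X act d sigma).

Definition hits k (phi : X ^^ (d k)) (x : X) (e : R) : set 'I_(d k) :=
  [set j | rho (phi j) x < e].

(** For fixed [x] and [e], the index sets [S] form an ideal containing the finite sets; restricting
    to [S] lets different microstates serve different indices. *)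
Definition chargeable (x : X) (e : R) (S : set nat) : Prop :=
  exists2 phi : forall k, X ^^ (d k), microstates phi &
  exists2 c : R, 0 < c &
    \forall k \near \oo, S k -> c <= unif R (hits (phi k) x e).

(** The microstate for [S] is used on [S], the one for [T] elsewhere. *)
Lemma chargeableU x e S T :
  chargeable x e S -> chargeable x e T -> chargeable x e (S `|` T).
Proof.
move=> [phi phiP [c c0 h]] [psi psiP [c' c'0 h']].
exists (fun k => if k \in S then phi k else psi k).
  exact: (microstates_glue sigmaP X_compact rhoP).
exists (Num.min c c'); first by rewrite lt_min c0.
apply: filterS2 h h' => k hS hT ST; rewrite ge_min.
case: (boolP (k \in S)) => [/set_mem/hS -> //|/negP nS]; case: ST => [/mem_set //|/hT ->].
by rewrite orbT.
Qed.

Lemma chargeable_sub x e S T : T `<=` S -> chargeable x e S -> chargeable x e T.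
Proof.
move=> TS [phi phiP [c c0 h]]; exists phi => //; exists c => //.
by apply: filterS h => k hk /TS.
Qed.

Lemma chargeable_finite x e S : (\forall k \near \oo, ~ S k) -> chargeable x e S.
Proof.
move=> nS; exists (fun k _ => 1%g).
  exact: (microstates1 sigmaP X_compact rhoP actP).
by exists 1 => //; apply: filterS nS.
Qed.

(** When [setT] is not chargeable, the complements of chargeable sets form a proper filter finer
    than the cofinite one; any ultrafilter extending it avoids the whole ideal. *)
Lemma nonchargeable_ultrafilter x e : ~ chargeable x e setT ->
  exists F : set_system nat, [/\ UltraFilter F, \oo `<=` F &
    forall S, chargeable x e S -> ~ F S].
Proof.
move=> nT; pose F0 : set_system nat := [set S | chargeable x e (~` S)].
have F0F : ProperFilter F0.
  split; first by rewrite /F0 /= setC0.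
  split; rewrite /F0 /=.
  - by rewrite setCT; apply: chargeable_finite; apply: nearW => k [].
  - by move=> A B QA QB; rewrite /F0 /= setCI; apply: chargeableU.
  - by move=> A B AB; apply: chargeable_sub; apply: subsetC.
have [F [FU F0S]] := ultraFilterLemma F0F.
exists F; split => // [S ooS|S cS FS].
  by apply/F0S/chargeable_finite; apply: filterS ooS => k Sk; apply.
have : F (~` S) by apply: F0S; rewrite /F0 /= setCK.
by move=> /(filterI FS) /filter_ex[k []].
Qed.

Section Ultra.
Variable F : set_system nat.
Hypothesis (F_ultra : UltraFilter F) (F_oo : \oo `<=` F).

Let F_proper : ProperFilter F := @ultra_proper _ _ F_ultra.

(** The microstate and the density [c] may depend on the scale [e]; only the ultrafilter is
    fixed. *)
Definition charged : set X := [set x | forall e : R, 0 < e ->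
  exists2 phi : forall k, X ^^ (d k), microstates phi &
  exists2 c : R, 0 < c & F [set k | c <= unif R (hits (phi k) x e)]].

Lemma charged_closed : closed charged.
Proof.
move=> x clx e e0; have e20 : 0 < e / 2 by rewrite divr_gt0.
have [y [yC /= xy]] := clx _ (near_rho rhoP x e20).
have [phi phiP [c c0 h]] := yC _ e20.
exists phi => //; exists c => //; apply: filterS h => k /= hk.
apply: le_trans hk (le_unif _) => j; rewrite /hits /= => jy.
by have := cmetric_triangle rhoP (phi k j) y x; rewrite (cmetric_sym rhoP y); lra.
Qed.

Lemma charged1 : charged 1%g.
Proof.
move=> e e0; exists (fun k _ => 1%g).
  exact: (microstates1 sigmaP X_compact rhoP actP).
exists 1 => //; apply: F_oo; apply: filterS (dim_gt0 sigmaP) => k dk.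
rewrite /= (_ : hits _ _ _ = setT) ?unif_setT //.
by apply/seteqP; split => // j _; rewrite /hits /= (rhoxx rhoP).
Qed.

Lemma chargedV x : charged x -> charged (x^-1)%g.
Proof.
move=> xC e e0.
have [r r0 hr] := continuous_rho rhoP x (@tinvg_continuous X) e0.
have [phi phiP [c c0 h]] := xC _ r0.
exists (fun k j => (phi k j)^-1)%g; first exact: microstates_inv.
exists c => //; apply: filterS h => k /= hk.
apply: le_trans hk (le_unif _) => j; rewrite /hits /= => jx.
by rewrite (cmetric_sym rhoP); apply: hr; rewrite /= (cmetric_sym rhoP).
Qed.

(** The same microstate works: outside its defect set of density below [c / 2], a visit near [x] at
    [j] gives a visit near [act g x] at [sigma k g j], and permuting vertices preserves density. *)
Lemma charged_act g x : charged x -> charged (act g x).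
Proof.
move=> xC e e0; have e20 : 0 < e / 2 by rewrite divr_gt0.
have [r r0 hr] := continuous_rho rhoP x (alg_act_continuous actP (g := g)) e20.
have [phi phiP [c c0 h]] := xC _ r0.
have c20 : 0 < c / 2 by rewrite divr_gt0.
exists phi => //; exists (c / 2) => //.
have /(microstatesP sigmaP X_compact rhoP)/(_ g _ e20 _ c20)/F_oo := phiP.
apply: filterS2 h => k /= hk h2.
rewrite -(unif_perm (sigma k g)).
suff : c <= unif R (defect (sigma := sigma) (act := act) (rho := rho) g (e / 2) (phi k)) +
    unif R [set j | hits (phi k) (act g x) e (sigma k g j)] by lra.
apply: le_trans hk (unif_le_setD _) => j; rewrite /hits /defect /= => jx.
case: (lerP (e / 2) _) => h3; [by left|right].
have := hr (phi k j); rewrite /= (cmetric_sym rhoP) => /(_ jx) h4.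
have := cmetric_triangle rhoP (phi k (sigma k g j)) (act g (phi k j)) (act g x).
rewrite (cmetric_sym rhoP (phi k (sigma k g j)) (act g (phi k j))).
rewrite (cmetric_sym rhoP (act g (phi k j)) (act g x)); lra.
Qed.

(** The visits of [phi] to [x] and of [psi] to [y] may be disjoint. Finitely many commutant
    translates of the former cover all but [c' / 2], so one of them meets the latter in positive
    density for [F]-many [k]; multiply that translate of [phi] by [psi]. *)
Lemma chargedM x y : charged x -> charged y -> charged (x * y)%g.
Proof.
move=> xC yC e e0.
have [r r0 hr] := rho_mulg_uniform rhoP X_compact e0.
have [phi phiP [c c0 hx]] := xC _ r0.
have [psi psiP [c' c'0 hy]] := yC _ r0.
(* Off the [F]-large set where [phi] charges [x], the hit set is replaced by everything. *)
pose S := [set k | c <= unif R (hits (phi k) x r)].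
pose A k : set 'I_(d k) := if k \in S then hits (phi k) x r else setT.
have m0 : 0 < Num.min c 1 by rewrite lt_min c0 ltr01.
have c'20 : 0 < c' / 2 by rewrite divr_gt0.
have [|n [tau [tauP cov]]] := ergodic_cover sigmaP sigma_ergodic (A := A) m0 c'20.
  apply: filterS (dim_gt0 sigmaP) => k dk; rewrite /A ge_min.
  by case: ifPn => [/set_mem -> //|_]; rewrite unif_setT // lexx orbT.
have [i hi] : exists i : 'I_n, F [set k | c' / 2 / n.+1%:R <=
    unif R (hits (psi k) y r `&` [set j | hits (phi k) x r ((tau i k)^-1%g j)])].
  apply: ultra_pigeonhole => //; apply: filterS3 hx hy (F_oo cov) => k /= kS hk hcov.
  apply: unif_meet => //; move: hcov; rewrite /A mem_set //.
  by lra.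
exists (fun k j => phi k ((tau i k)^-1%g j) * psi k j)%g.
  apply: (microstates_mul sigmaP X_compact rhoP actP) => //.
  exact: (microstates_perm sigmaP X_compact rhoP).
exists (c' / 2 / n.+1%:R); first by rewrite divr_gt0.
apply: filterS hi => k /= hk; apply: le_trans hk (le_unif _) => j [] /=.
rewrite /hits /= => h1 h2; exact: hr.
Qed.

Lemma charged_subgroup : closed_invariant_subgroup act charged.
Proof.
split; [exact: charged_closed | exact: charged1 | exact: chargedM | exact: chargedV |].
by move=> g _ [x xC <-]; exact: charged_act.
Qed.

(** By compactness it suffices to work near each [x]. Near a charged point the distance is below
    [e]. Near an uncharged one, at some scale no microstate has density of visits at least [c] along
    [F], so the ultrafilter contains the indices with smaller density. *)
Lemma near_charged (phi : forall k, X ^^ (d k)) (e c : R) : microstates phi ->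
  0 < e -> 0 < c ->
  F [set k | unif R [set j | e <= dist_to rho charged (phi k j)] < c].
Proof.
move=> phiP e0; move: c.
pose Q (A : set X) := forall c : R, 0 < c ->
  F [set k | unif R [set j | A (phi k j) /\ e <= dist_to rho charged (phi k j)] < c].
suff QT : Q setT.
  move=> c /QT; apply: filterS => k; apply: le_lt_trans.
  by apply: le_unif => j /= ej; split.
apply: compact_ideal => //.
- move=> r r0; apply: filterS filterT => k _ /=.
  rewrite (_ : mkset _ = set0) ?unif_set0 //.
  by apply/seteqP; split => // j [].
- move=> A B BA QA r /QA; apply: filterS => k; apply: le_lt_trans.
  by apply: le_unif => j /= [/BA].
- move=> A B QA QB r r0; have r20 : 0 < r / 2 by rewrite divr_gt0.
  apply: filterS2 (QA _ r20) (QB _ r20) => k /= h1 h2.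
  have -> : r = r / 2 + r / 2 by lra.
  apply: le_lt_trans (ltrD h1 h2); apply: unif_le_setD => j /=.
  by move=> [[] h3 h4]; [left|right].
have charged0 : charged !=set0 by exists 1%g; exact: charged1.
move=> x; case: (pselect (charged x)) => [xC|].
  exists [set y | rho x y < e]; first exact: near_rho.
  move=> r r0; apply: filterS filterT => k _ /=.
  rewrite (_ : mkset _ = set0) ?unif_set0 //.
  apply/seteqP; split => // j [/= h1 h2].
  have := dist_to_le rhoP charged0 (phi k j) xC.
  by rewrite (cmetric_sym rhoP); lra.
move=> /existsNP[r /not_implyP[r0 hr]].
exists [set y | rho x y < r]; first exact: near_rho.
move=> c c0; case: (in_ultra_setVsetC [set k | c <= unif R (hits (phi k) x r)] F_ultra) => h.
  by exfalso; apply: hr; exists phi => //; exists c.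
apply: filterS h => k /= /negP; rewrite -ltNge; apply: le_lt_trans.
by apply: le_unif => j /= []; rewrite /hits /= (cmetric_sym rhoP).
Qed.

Lemma charged_subsequence (phi : forall k, X ^^ (d k)) : microstates phi ->
  exists kl : nat -> nat, {homo kl : m n / (m < n)%N} /\
    rho2_set rho (phi (kl l)) (@set_power X charged (d (kl l))) @[l --> \oo] --> (0 : R).
Proof.
move=> phiP; have charged0 : charged !=set0 by exists 1%g; exact: charged1.
have [M M0 rhoM] := rho_bounded rhoP X_compact.
pose P e : set nat := [set k | rho2_set rho (phi k) (@set_power X charged (d k)) < e].
have FP (e : R) : 0 < e -> F (P e).
  move=> e0; have := near_charged phiP (e := e / 2) (c := (e / (2 * M)) ^+ 2).
  move=> /(_ _ _)/filterS; apply; rewrite ?divr_gt0 ?exprn_gt0 ?divr_gt0 ?mulr_gt0 //.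
  by move=> k /=; apply: rho2_set_lt.
have next (n l : nat) : exists k, (n < k)%N /\ P l.+1%:R^-1 k.
  have Fn : F [set k | (n < k)%N] by apply: F_oo; exists n.+1.
  have l0 : 0 < l.+1%:R^-1 :> R by rewrite invr_gt0.
  by have [k [h1 h2]] := filter_ex (filterI Fn (FP _ l0)); exists k.
have [f fP] := choice (fun p : nat * nat => next p.1 p.2).
(* Each [P l.+1%:R^-1] belongs to [F] and hence meets every tail, so indices can be picked one after
   another, each beyond the last. *)
pose kl := fix kl l := if l is l'.+1 then f (kl l', l) else f (0%N, 0%N).
have klS l : (kl l < kl l.+1)%N by case: (fP (kl l, l.+1)).
have klP l : P l.+1%:R^-1 (kl l).
  by case: l => [|l]; [case: (fP (0%N, 0%N)) | case: (fP (kl l, l.+1))].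
exists kl; split; first exact: homo_ltn ltn_trans klS.
apply: (@squeeze_cvgr _ _ _ _ (fun=> 0) (fun l => l.+1%:R^-1)).
- apply: nearW => l; rewrite (ltW (klP l)) andbT; exact: rho2_set_ge0.
- exact: cvg_cst.
- exact: cvg_harmonic.
Qed.

End Ultra.

End Charged.

(** * Random words *)

Definition mean {R : realType} {I : finType} (F : I -> R) : R :=
  #|I|%:R^-1 * \sum_i F i.

Section Mean.
Context {R : realType} {I : finType}.
Implicit Types F : I -> R.

Lemma meanB F F' : mean F - mean F' = mean (fun i => F i - F' i).
Proof. by rewrite /mean -mulrBr -sumrB. Qed.

Lemma mean_le F (c : R) : (0 < #|I|)%N -> (forall i, F i <= c) -> mean F <= c.
Proof.
move=> I0 Fc; rewrite /mean ler_pdivrMl ?ltr0n //.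
apply: le_trans (ler_sum _ (fun i _ => Fc i)) _.
by rewrite sumr_const mulr_natl.
Qed.

Lemma norm_mean_le F (c : R) : (0 < #|I|)%N -> (forall i, `|F i| <= c) -> `|mean F| <= c.
Proof.
move=> I0 Fc; rewrite /mean normrM ger0_norm ?invr_ge0 //.
apply: le_trans (mean_le I0 Fc).
by rewrite ler_wpM2l ?invr_ge0 // ler_norm_sum.
Qed.

Lemma mean_pair (J : finType) (F : I * J -> R) :
  mean F = mean (fun i => mean (fun j => F (i, j))).
Proof.
rewrite /mean card_prod natrM invfM -mulr_sumr mulrA; congr (_ * _).
by rewrite pair_bigA; apply: eq_bigr => -[].
Qed.

End Mean.

(** * Contraction of oscillation by averaging *)

Section Contraction.
Context {R : realType} {X : topologicalGroupType} {rho : X -> X -> R}.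

(* Quantifying over two-sided translates makes the class stable under the averages
   [fun x => mean (fun w => f (p w * x))]. *)
Definition modulus (e eta : R) (f : X -> R) : Prop :=
  forall s t a b, rho a b < e -> `|f (s * a * t)%g - f (s * b * t)%g| <= eta.

Definition oscillation_le (D : R) (f : X -> R) : Prop :=
  forall x y, `|f x - f y| <= D.

(* For [x], [x'] and any [i1], some [W i0 * x] is [e]-close to [W i1 * x']; pairing
   these two terms gains [D - eta] in one of the [#|I|] terms of the average. *)
Lemma mean_contraction (I : finType) (W : I -> X) (h : X -> R) (e eta D : R) :
  (0 < #|I|)%N -> (forall x, exists i, rho (W i) x < e) ->
  modulus e eta h -> oscillation_le D h ->
  oscillation_le (eta * #|I|%:R^-1 + (1 - #|I|%:R^-1) * D)
    (fun x => mean (fun i => h (W i * x)%g)).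
Proof.
move=> I0 Wd hm hD.
have m0 : 0 < #|I|%:R :> R by rewrite ltr0n.
suff H x x' : mean (fun i => h (W i * x)%g) - mean (fun i => h (W i * x')%g) <=
    eta * #|I|%:R^-1 + (1 - #|I|%:R^-1) * D.
  by move=> x x'; rewrite ler_norml H lerNl opprB H.
have [i1 _] : exists i, i \in I by apply/card_gt0P.
have [i0 hi0] := Wd (W i1 * x' * x^-1)%g.
rewrite /mean -mulrBr [X in _ * (_ - X)](reindex_inj (@perm_inj _ (tperm i0 i1))) /=.
rewrite -sumrB (bigD1 i0) //= tpermL.
have h1 : h (W i0 * x)%g - h (W i1 * x')%g <= eta.
  have := hm 1%g x _ _ hi0; rewrite !mul1g -!mulgA mulVg mulg1.
  by apply: le_trans; rewrite ler_norm.
have h2 : \sum_(i | i != i0) (h (W i * x)%g - h (W (tperm i0 i1 i) * x')%g) <= (#|I|%:R - 1) * D.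
  apply: (@le_trans _ _ (\sum_(i | i != i0) D)).
    by apply: ler_sum => i _; exact: le_trans (ler_norm _) (hD _ _).
  by rewrite sumr_const cardC1 -subn1 -[leLHS]mulr_natl natrB.
rewrite ler_pdivrMl //; apply: le_trans (lerD h1 h2) _.
rewrite le_eqVlt; apply/orP; left; apply/eqP; field.
by rewrite gt_eqF.
Qed.

End Contraction.

Arguments modulus {R X} rho e eta f.

Section Walk.
Context {R : realType} {G : groupType} {d : nat -> nat}.
Context {sigma : forall k, G -> 'S_(d k)}.
Hypothesis sigmaP : sofic_approximation R sigma.
Hypothesis sigma_ergodic : ergodic_commutant R sigma.
Context {X : topologicalGroupType} {act : G -> X -> X} {rho : X -> X -> R}.
Hypothesis X_compact : compact [set: X].
Hypothesis rhoP : compatible_metric rho.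
Hypothesis actP : algebraic_action act.

Local Notation microstates := (@topological_microstates R G X act d sigma).
Local Notation configurations := (forall k, X ^^ (d k)).

Hypothesis charge_all : forall x (e : R), 0 < e ->
  chargeable (sigma := sigma) (act := act) (rho := rho) x e setT.

(** For one [x], the commutant translates of a microstate charging [x] come near [x] at almost every
    vertex. Compactness then combines finitely many such families by disjoint union. *)
Lemma dense_family (e r : R) : 0 < e -> 0 < r ->
  exists (I : finType) (phi : I -> configurations),
    [/\ (0 < #|I|)%N, forall i, microstates (phi i) &
      \forall k \near \oo,
        unif R [set j | ~ forall x, exists i, rho (phi i k j) x < e] < r].
Proof.
move=> e0; move: r.
pose Q (A : set X) := forall r : R, 0 < r ->
  exists (I : finType) (phi : I -> configurations),
    [/\ (0 < #|I|)%N, forall i, microstates (phi i) &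
      \forall k \near \oo,
        unif R [set j | ~ forall x, A x -> exists i, rho (phi i k j) x < e] < r].
have mono (A B : set X) (I J : finType) (phi : I -> configurations) (psi : J -> configurations) k :
    (forall j, (forall x, A x -> exists i, rho (phi i k j) x < e) ->
      forall x, B x -> exists i, rho (psi i k j) x < e) ->
    unif R [set j | ~ forall x, B x -> exists i, rho (psi i k j) x < e] <=
    unif R [set j | ~ forall x, A x -> exists i, rho (phi i k j) x < e].
  by move=> AB; apply: le_unif => j /= nB /AB.
suff QT : Q setT.
  move=> r /QT[I [phi [I0 phiP h]]]; exists I, phi; split => //.
  apply: filterS h => k; apply: le_lt_trans; apply: le_unif => j /= nh hh.
  by apply: nh => x; apply: hh.
have one := microstates1 sigmaP X_compact rhoP actP.
apply: compact_ideal => //.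
- move=> r r0; exists unit, (fun _ k _ => 1%g); split; rewrite ?card_unit //.
  apply: nearW => k; rewrite (_ : mkset _ = set0) ?unif_set0 //.
  by apply/seteqP; split => // j []; move=> x [].
- move=> A B BA QA r /QA[I [phi [I0 phiP h]]]; exists I, phi; split => //.
  apply: filterS h => k; apply: le_lt_trans; apply: mono => j hA x /BA; exact: hA.
- move=> A B QA QB r r0; have r20 : 0 < r / 2 by rewrite divr_gt0.
  have [I [phi [I0 phiP hA]]] := QA _ r20; have [J [psi [J0 psiP hB]]] := QB _ r20.
  exists (I + J)%type, (fun i => match i with inl i => phi i | inr i => psi i end).
  split; first by rewrite card_sum addn_gt0 I0.
    by case.
  apply: filterS2 hA hB => k h1 h2.
  have -> : r = r / 2 + r / 2 by lra.
  apply: le_lt_trans (ltrD h1 h2); apply: unif_le_setD => j /=.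
  rewrite -[X in X -> _]/(~ _) => h; apply: contrapT => /not_orP[/contrapT kA /contrapT kB].
  apply: h => x [/kA[i]|/kB[i]]; [by exists (inl i) | by exists (inr i)].
move=> x; have e20 : 0 < e / 2 by rewrite divr_gt0.
exists [set y | rho x y < e / 2]; first exact: near_rho.
move=> r r0; have [phi phiP [c c0 hc]] := charge_all x e20.
have {}hc : \forall k \near \oo, c <= unif R (hits (rho := rho) (phi k) x (e / 2)).
  by apply: filterS hc => k; apply.
have [n [tau [tauP cov]]] := ergodic_cover sigmaP sigma_ergodic c0 r0 hc.
(* [None], which stands for [phi] itself, keeps the family nonempty even when [n = 0]. *)
exists (option 'I_n), (fun o => if o is Some i then fun k j => phi k ((tau i k)^-1%g j) else phi).
split; first by rewrite card_option.
  by case=> // i; apply: (microstates_perm sigmaP X_compact rhoP).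
apply: filterS cov => k; apply: le_lt_trans; apply: le_unif => j /= nh [i _ hi].
apply: nh => y xy; exists (Some i) => /=; move: hi; rewrite /hits /=.
have := cmetric_triangle rhoP (phi k ((tau i k)^-1%g j)) x y; lra.
Qed.

(** The members are the words of length [N]. With [q = 1 - #|I|%:R^-1], one more letter turns the
    bound into [eta * (1 - q) + q * (eta + q ^+ N * D)], so [eta] does not accumulate and the rate
    depends on [#|I|] only. *)
Lemma walk_family (I : finType) (phi : I -> configurations) (e : R) (N : nat) :
  (0 < #|I|)%N -> (forall i, microstates (phi i)) ->
  exists (J : finType) (psi : J -> configurations),
    [/\ (0 < #|J|)%N, forall w, microstates (psi w) &
      forall k j, (forall x, exists i, rho (phi i k j) x < e) ->
      forall eta D f, modulus rho e eta f -> oscillation_le D f ->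
      oscillation_le (eta + (1 - #|I|%:R^-1) ^+ N * D)
        (fun x => mean (fun w => f (psi w k j * x)%g))].
Proof.
move=> I0 phiP; elim: N => [|N [J [psi [J0 psiP IH]]]].
  exists unit, (fun _ k _ => 1%g); split; rewrite ?card_unit //.
    by move=> _; exact: (microstates1 sigmaP X_compact rhoP actP).
  move=> k j dj eta D f fm fD x y.
  (* Density provides a pair of [e]-close points, at which [modulus] bounds an absolute value by
     [eta]. *)
  have eta0 : 0 <= eta.
    have [i hi] := dj 1%g; have := fm 1%g 1%g _ _ hi.
    by apply: le_trans.
  rewrite expr0 mul1r meanB; apply: norm_mean_le => [|_]; first by rewrite card_unit.
  by apply: le_trans (fD _ _) _; rewrite lerDr.
exists (I * J)%type, (fun p k j => psi p.2 k j * phi p.1 k j)%g; split.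
- by rewrite card_prod muln_gt0 I0.
- by move=> p; apply: (microstates_mul sigmaP X_compact rhoP actP).
move=> k j dj eta D f fm fD.
pose h x := mean (fun w => f (psi w k j * x)%g).
have hm : modulus rho e eta h.
  move=> s t a b ab; rewrite /h meanB; apply: norm_mean_le => // w.
  by rewrite !mulgA; apply: fm.
have := mean_contraction I0 dj hm (IH k j dj eta D f fm fD).
set q := 1 - _ => H x y.
have hE z : mean (fun p : I * J => f (psi p.2 k j * phi p.1 k j * z)%g) =
    mean (fun i => h (phi i k j * z)%g).
  rewrite mean_pair; congr (_ * _); apply: eq_bigr => i _.
  by congr (_ * _); apply: eq_bigr => w _; rewrite mulgA.
rewrite !hE; apply: le_trans (H x y) _; rewrite le_eqVlt; apply/orP; left.
by apply/eqP; rewrite /q exprS; ring.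
Qed.

(** The word length is chosen so that the geometric factor times [D] is at most [r]; the only bad
    vertices left are those where the letters fail to be [r]-dense. *)
Lemma mixing_family (r D : R) : 0 < r ->
  exists (J : finType) (psi : J -> configurations),
    [/\ (0 < #|J|)%N, forall w, microstates (psi w) &
      \forall k \near \oo,
        unif R [set j | ~ forall eta f, modulus rho r eta f -> oscillation_le D f ->
          oscillation_le (eta + r) (fun x => mean (fun w => f (psi w k j * x)%g))] < r].
Proof.
move=> r0; have [I [phi [I0 phiP hI]]] := dense_family r0 r0.
have [N hN] : exists N, (1 - #|I|%:R^-1) ^+ N * D <= r.
  have q1 : `|1 - #|I|%:R^-1 : R| < 1.
    have i0 : 0 < #|I|%:R^-1 :> R by rewrite invr_gt0 ltr0n.
    have i1 : #|I|%:R^-1 <= 1 :> R by rewrite invf_le1 ?ltr0n // ler1n.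
    by rewrite ger0_norm; lra.
  have : (1 - #|I|%:R^-1) ^+ n * D @[n --> \oo] --> (0 * D : R).
    by apply: cvgMr_tmp; exact: cvg_expr.
  rewrite mul0r => /cvgrPdist_lt/(_ r r0)[N _ /(_ N (leqnn N))] /=.
  by rewrite sub0r normrN => /(le_lt_trans (ler_norm _))/ltW; exists N.
have [J [psi [J0 psiP hJ]]] := walk_family r N I0 phiP.
exists J, psi; split => //; apply: filterS hI => k; apply: le_lt_trans.
apply: le_unif => j /= nh dj; apply: nh => eta f fm fD x y.
by apply: le_trans (hJ k j dj eta D f fm fD x y) _; rewrite lerD2l.
Qed.

End Walk.

(** * Measures *)

Section Probability.
Context {d : measure_display} {T : measurableType d} {R : realType}.
Implicit Types (P : probability T R) (f : T -> R).

Lemma integrable_bounded P f (M : R) : measurable_fun setT f ->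
  (forall x, `|f x| <= M) -> P.-integrable setT (EFin \o f).
Proof.
move=> mf fM; apply: measurable_bounded_integrable => //.
  by rewrite /= probability_setT ltry.
exists M; split; first exact: num_real.
by move=> x Mx t _ /=; apply: le_trans (fM t) (ltW Mx).
Qed.

Lemma Rintegral_probability_cst P (r : R) : \int[P]_x r = r.
Proof. by rewrite Rintegral_cst //= probability_setT mulr1. Qed.

Lemma Rintegral_sum P (I : Type) (s : seq I) (F : I -> T -> R) (M : I -> R) :
  (forall i, measurable_fun setT (F i)) -> (forall i x, `|F i x| <= M i) ->
  \int[P]_x (\sum_(i <- s) F i x) = \sum_(i <- s) \int[P]_x F i x.
Proof.
move=> mF FM; elim: s => [|i s IH].
  by under eq_Rintegral do rewrite big_nil; rewrite big_nil Rintegral_probability_cst.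
under eq_Rintegral do rewrite big_cons.
rewrite big_cons -IH RintegralD //; first exact: integrable_bounded (FM i).
apply: (@integrable_bounded _ _ (\sum_(i <- s) M i)).
  exact: measurable_sum.
by move=> x; apply: le_trans (ler_norm_sum _ _ _) _; apply: ler_sum.
Qed.

(** Integrate the pointwise bound of [f] by [a] plus [M] times the indicator of the complement of
    [E]. *)
Lemma Rintegral_le_setC P f (E : set T) (a M : R) : measurable_fun setT f ->
  measurable E -> (forall x, `|f x| <= M) -> (forall x, E x -> f x <= a) -> 0 <= a ->
  \int[P]_x f x <= a + M * fine (P (~` E)).
Proof.
move=> mf mE fM fa a0.
have M0 : 0 <= M by apply: le_trans (fM point); exact: normr_ge0.
have mI : measurable_fun setT (\1_(~` E) : T -> R) by apply: measurable_indic; exact: measurableC.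
have iI : P.-integrable setT (EFin \o (\1_(~` E) : T -> R)).
  by apply: (@integrable_bounded _ _ 1) => // x; rewrite indicE ger0_norm // lern1 leq_b1.
have iMI : P.-integrable setT (EFin \o (fun x => M * \1_(~` E) x)).
  apply: (@integrable_bounded _ _ M) => [|x]; first exact: measurable_funM.
  rewrite normrM ger0_norm // indicE [X in M * X]ger0_norm // ler_piMr //.
  by rewrite lern1 leq_b1.
have -> : a + M * fine (P (~` E)) = \int[P]_x (a + M * \1_(~` E) x).
  rewrite RintegralD //; last first.
    by apply: (@integrable_bounded _ _ a) => // x; rewrite ger0_norm.
  rewrite Rintegral_probability_cst RintegralZl // /Rintegral integral_indic ?setIT //.
  exact: measurableC.
apply: le_Rintegral => //; first exact: integrable_bounded fM.
  apply: (@integrable_bounded _ _ (a + M)) => [|x].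
    by apply: measurable_funD => //; exact: measurable_funM.
  rewrite indicE; case: (x \in _); rewrite ?mulr1 ?mulr0 ger0_norm //; lra.
move=> x _; rewrite indicE; case: (pselect (E x)) => [Ex|nE].
  by rewrite memNset ?mulr0 ?addr0 ?fa.
by rewrite mem_set // mulr1; have := fM x; have := ler_norm (f x); lra.
Qed.

End Probability.

(** * Uniform measures on finite families *)

Section EmpiricalMeasure.
Context {d : measure_display} {T : measurableType d} (R : realType).
Context {J : finType} (p : J -> T) (j0 : J).

(** [msum] is indexed by naturals, so [J] is enumerated, with [j0] as the default of [nth]. *)
Definition dirac_sum := msum (fun n => \d_(p (nth j0 (enum J) n)) : {measure set T -> \bar R}) #|J|.

Definition empirical : probability T R := mnormalize dirac_sum \d_(p j0).

Let card_gt0 : 0 < #|J|%:R :> R.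
Proof. by rewrite ltr0n; apply/card_gt0P; exists j0. Qed.

Let sum_enum (F : J -> R) : \sum_(n < #|J|) F (nth j0 (enum J) n) = \sum_j F j.
Proof.
rewrite -[RHS]big_enum (big_nth j0) big_mkord cardE; apply: eq_bigr => i _ //.
Qed.

Lemma empiricalE (A : set T) : empirical A = (mean (fun j => \1_A (p j)))%:E.
Proof.
have dsE (B : set T) : dirac_sum B = (\sum_j \1_B (p j))%:E.
  by rewrite /dirac_sum /msum -sum_enum -sumEFin; apply: eq_bigr.
have dsT : dirac_sum setT = #|J|%:R%:E.
  rewrite dsE; under eq_bigr do rewrite indicT.
  by rewrite sumr_const.
rewrite /empirical /= /mnormalize /= -/(dirac_sum setT) dsT eqe gt_eqF //=.
rewrite -/(dirac_sum A) dsE -EFinM mulrC.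
by congr (_%:E); congr (_ * _).
Qed.

Lemma Rintegral_empirical (f : T -> R) (M : R) : measurable_fun setT f ->
  (forall x, `|f x| <= M) -> \int[empirical]_x f x = mean (f \o p).
Proof.
move=> mf fM.
have ge0 (g : T -> R) : measurable_fun setT g -> (forall x, 0 <= g x) ->
    \int[empirical]_x g x = mean (g \o p).
  move=> mg g0; rewrite /Rintegral.
  have i0 : 0 <= #|J|%:R^-1 :> R by rewrite invr_ge0 ltW.
  have mg' : measurable_fun setT (EFin \o g) by exact/measurable_EFinP.
  rewrite (eq_measure_integral (mscale (NngNum i0) dirac_sum)); last first.
    move=> A mA _; rewrite [LHS]empiricalE /mscale /= /mean EFinM; congr (_ * _)%E.
    by rewrite -sum_enum /dirac_sum /msum -sumEFin; apply: eq_bigr.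
  rewrite ge0_integral_mscale //; last by move=> x _; rewrite lee_fin.
  rewrite /dirac_sum ge0_integral_measure_sum //; last by move=> x _; rewrite lee_fin.
  under eq_bigr => n _ do rewrite integral_dirac // diracT mul1e.
  by rewrite sumEFin -EFinM /= (sum_enum (g \o p)).
(* Adding [M] reduces the signed case to the nonnegative one; the constant cancels at the end. *)
have fM0 x : 0 <= f x + M by have := fM x; rewrite ler_norml; lra.
have mM : measurable_fun setT (fun x => f x + M) by exact: measurable_funD.
have := ge0 _ mM fM0.
rewrite RintegralD //; last 2 first.
- exact: integrable_bounded fM.
- by apply: (@integrable_bounded _ _ _ _ _ `|M|) => //.
rewrite Rintegral_probability_cst /mean big_split /= sumr_const -[M *+ _]mulr_natl mulrDr.
by rewrite mulKf ?gt_eqF // => /addIr.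
Qed.

End EmpiricalMeasure.

(** * Integrals of continuous functions: marginals and translations *)

Section Borel.
Context {R : realType}.

Lemma continuous_measurable (X : ptopologicalType) (f : X -> R) :
  continuous f -> measurable_fun [set: borel X] f.
Proof.
move=> /continuousP cf; apply: (measurability _ (RGenOpens.measurableE R)).
move=> _ [_ [a [b ->] <-]]; rewrite setTI; apply: sub_sigma_algebra.
exact/cf/interval_open.
Qed.

Lemma Rintegral_marginal (X : ptopologicalType) n (mu : probability (borel (X ^^ n)) R)
    (j : 'I_n) (f : X -> R) (M : R) : continuous f -> (forall x, `|f x| <= M) ->
  \int[marginal mu j]_x f x = \int[mu]_phi f (phi j).
Proof.
move=> cf fM; have mf := continuous_measurable cf.
rewrite /Rintegral /marginal integral_distribution //; first exact/measurable_EFinP.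
apply: (@integrable_bounded _ _ _ _ (f \o coord j) M) => [|x]; last exact: fM.
apply: measurableT_comp => //; exact: measurable_coord.
Qed.

Lemma Rintegral_haar (X : topologicalGroupType) (m : probability (borel X) R)
    (f : X -> R) (M : R) (w : X) : is_haar m -> continuous f ->
  (forall x, `|f x| <= M) -> \int[m]_x f (w * x)%g = \int[m]_x f x.
Proof.
move=> mH cf fM.
have cw (v : X) : continuous (fun x : X => v * x)%g.
  by apply: continuous_mulg => [x|x]; [exact: cvg_cst | exact: cvg_id].
have mw : measurable_fun [set: borel X] (fun x : borel X => (w * x)%g : borel X).
  apply: (@measurability _ _ (borel X) (borel X) _ _ (@open X)) => //.
  move=> _ [B oB <-]; rewrite setTI; apply: sub_sigma_algebra.
  by move/continuousP: (cw w); apply.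
have mf := continuous_measurable cf.
pose mulw (x : borel X) : borel X := (w * x)%g.
rewrite /Rintegral -[in RHS](@eq_measure_integral _ _ _ _ m (pushforward m mulw)).
  rewrite integral_pushforward //; first exact/measurable_EFinP.
  rewrite preimage_setT.
  apply: (@integrable_bounded _ (borel X) _ m (f \o mulw) M) => [|x]; last exact: fM.
  exact: (measurableT_comp mf mw).
(* The preimage of [A] under translation by [w] is its translate by the inverse of [w], to which
   invariance applies. *)
move=> A mA _; rewrite -[RHS](mH (w^-1)%g) // /pushforward; congr (m _).
apply/seteqP; split => [x Ax|_ [y Ay <-]] /=.
  by exists (w * x)%g => //; rewrite /mulw mulKg.
by rewrite /mulw mulVKg.
Qed.

End Borel.

(** Let [f k] be the largest [n <= k] whose threshold [N n] has been passed by [k]. From [N 0] on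
    there is such an [n], so the maximum is attained and [P (f k) k] holds. *)
Lemma diagonal (P : nat -> nat -> Prop) :
  (forall n, \forall k \near \oo, P n k) ->
  exists f : nat -> nat, (forall n, \forall k \near \oo, (n <= f k)%N) /\
    \forall k \near \oo, P (f k) k.
Proof.
move=> h; have h' n : exists N, forall k, (N <= k)%N -> P n k.
  by have [N _ hN] := h n; exists N.
have [N hN] := choice h'.
exists (fun k => \max_(n < k.+1 | (N n <= k)%N) n); split.
  move=> n; exists (maxn n (N n)) => // k /=; rewrite geq_max => /andP[nk Nk].
  by rewrite -ltnS in nk; apply: (leq_bigmax_cond (Ordinal nk)).
exists (N 0%N) => // k /= Nk.
have [|n nk ->] := @eq_bigmax_cond _ [pred n : 'I_k.+1 | (N n <= k)%N] (@nat_of_ord k.+1).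
  by apply/card_gt0P; exists ord0.
exact: hN.
Qed.

Lemma countable_enum (G : groupType) : countable [set: G] ->
  exists e : nat -> G, forall g, exists i, e i = g.
Proof.
move=> /countable_injP[f finj].
have he i : exists g, (exists g', f g' = i) -> f g = i.
  case: (pselect (exists g', f g' = i)) => [[g gi]|ngi]; first by exists g.
  by exists 1%g => /ngi.
have [e eP] := choice he.
exists e => g; exists (f g); apply: finj; rewrite ?in_setT //.
by apply: eP; exists g.
Qed.

Lemma invS_gt0 (R : realType) n : 0 < n.+1%:R^-1 :> R.
Proof. by rewrite invr_gt0. Qed.

Lemma near_invS (R : realType) (f : nat -> nat) (e : R) :
  (forall n, \forall k \near \oo, (n <= f k)%N) ->
  0 < e -> \forall k \near \oo, (f k).+1%:R^-1 < e.
Proof.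
move=> foo e0; have /cvgrPdist_lt/(_ e e0)[N _ hN] := @cvg_harmonic R.
by apply: filterS (foo N) => k /hN /=; rewrite sub0r normrN ger0_norm // ltW // invS_gt0.
Qed.

(** * Microstates up to a finite tolerance *)

Section Approximation.
Context {R : realType} {G : groupType} {d : nat -> nat}.
Context {sigma : forall k, G -> 'S_(d k)}.
Hypothesis sigmaP : sofic_approximation R sigma.
Context {X : topologicalGroupType} {act : G -> X -> X} {rho : X -> X -> R}.
Hypothesis X_compact : compact [set: X].
Hypothesis rhoP : compatible_metric rho.
Variable enumG : nat -> G.
Hypothesis enumGP : forall g, exists i, enumG i = g.

Local Notation microstates := (@topological_microstates R G X act d sigma).

(** A condition on a single configuration: finitely many group elements, and one tolerance for both
    distance and density. Being a microstate concerns a whole sequence and cannot be tested at one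
    [k]. *)
Definition approx_microstate n k (phi : X ^^ (d k)) : Prop :=
  forall i : 'I_n, unif R (defect (sigma := sigma) (act := act) (rho := rho)
    (enumG i) n.+1%:R^-1 phi) < n.+1%:R^-1.

Lemma approx_microstate_near (phi : forall k, X ^^ (d k)) n : microstates phi ->
  \forall k \near \oo, approx_microstate n (phi k).
Proof.
move=> /(microstatesP sigmaP X_compact rhoP) phiP.
by apply: filter_forall => i; apply: phiP.
Qed.

(** Once [f k] exceeds the position of [g] and its tolerance drops below [e] and [r], the bound
    holds for all [phi] simultaneously, as needed for measures. *)
Lemma approx_microstate_defect (f : nat -> nat) g (e r : R) :
  (forall n, \forall k \near \oo, (n <= f k)%N) -> 0 < e -> 0 < r ->
  \forall k \near \oo, forall phi : X ^^ (d k), approx_microstate (f k) phi ->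
    unif R (defect (sigma := sigma) (act := act) (rho := rho) g e phi) < r.
Proof.
move=> foo e0 r0; have [i <-] := enumGP g.
apply: filterS3 (foo i.+1) (near_invS foo e0) (near_invS foo r0) => k ik ke kr phi phiP.
apply: le_lt_trans (lt_trans (phiP (Ordinal ik)) kr); apply: le_unif => j.
by rewrite /defect /=; apply: le_trans; exact: ltW.
Qed.

Lemma approx_microstates (f : nat -> nat) (phi : forall k, X ^^ (d k)) :
  (forall n, \forall k \near \oo, (n <= f k)%N) ->
  (\forall k \near \oo, approx_microstate (f k) (phi k)) -> microstates phi.
Proof.
move=> foo phiP; apply/(microstatesP sigmaP X_compact rhoP) => g e e0 r r0.
by apply: filterS2 (approx_microstate_defect g foo e0 r0) phiP => k; apply.
Qed.

(** Despite the non-strict inequality the set is open: near [phi] the finitely many open conditions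
    it satisfies persist, so the density can only grow. *)
Lemma open_unif_ge n (a : R) (V : 'I_n -> set (X ^^ n)) : (forall j, open (V j)) ->
  open [set phi : X ^^ n | a <= unif R [set j | V j phi]].
Proof.
move=> oV; rewrite openE => phi /= aphi.
have : \forall psi \near phi, forall j, V j phi -> V j psi.
  apply: (@filter_forall (X ^^ n) 'I_n (fun j psi => V j phi -> V j psi) (nbhs phi) _ _) => j.
  case: (pselect (V j phi)) => [Vj|nVj]; last by apply: nearW.
  have Vphi : nbhs phi (V j) by apply: open_nbhs_nbhs; split.
  by apply: filterS Vphi => psi.
by apply: filterS => psi h /=; apply: le_trans aphi (le_unif _) => j; apply: h.
Qed.

Hypothesis actP : algebraic_action act.

Lemma open_microstate_set k g (a : R) (U : set (X * X)) : open U ->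
  open [set phi : X ^^ (d k) | a <= unif R [set j | U (phi (sigma k g j), act g (phi j))]].
Proof.
move=> oU; apply: (@open_unif_ge _ _ (fun j phi => U (phi (sigma k g j), act g (phi j)))) => j.
have cp (i : 'I_(d k)) : continuous (fun phi : X ^^ (d k) => phi i).
  exact: (@proj_continuous 'I_(d k) (fun=> X) i).
have c : continuous (fun phi : X ^^ (d k) => (phi (sigma k g j), act g (phi j))).
  apply: continuous_pair; first exact: cp.
  by move=> phi; apply: (cvg_comp _ _ (cp j phi)); exact: (alg_act_continuous actP).
by move/continuousP: c; apply.
Qed.

(** Union bound over the first [n] group elements, each failing with probability below
    [r / n.+1%:R]. *)
Lemma probability_approx_microstate (mu : forall k, probability (borel (X ^^ (d k))) R) n (r : R) :
  asymptotically_supported act sigma mu -> 0 < r ->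
  \forall k \near \oo, exists E : set (borel (X ^^ (d k))),
    [/\ measurable E, forall phi, E phi -> approx_microstate n phi & fine (mu k (~` E)) < r].
Proof.
move=> muP r0.
pose U := [set p : X * X | rho p.1 p.2 < n.+1%:R^-1].
(* The slack [n.+2%:R^-1] makes the defect density strictly below [n.+1%:R^-1]. *)
pose E k (i : nat) : set (borel (X ^^ (d k))) := [set phi : X ^^ (d k) |
  1 - n.+2%:R^-1 <= unif R [set j | U (phi (sigma k (enumG i) j), act (enumG i) (phi j))]].
have mE k i : measurable (E k i).
  by apply: sub_sigma_algebra; apply: open_microstate_set; exact: open_rho.
have rn0 : 0 < r / n.+1%:R by rewrite divr_gt0.
have hE : \forall k \near \oo, forall i : 'I_n, fine (mu k (~` E k i)) < r / n.+1%:R.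
  apply: filter_forall => i.
  have oU : open U by exact: open_rho.
  have := muP (enumG i) n.+2%:R^-1 U (invS_gt0 R _) oU (diag_nbhs_rho rhoP (invS_gt0 R _)).
  move=> /fine_cvg/cvgrPdist_lt/(_ _ rn0); apply: filterS => k /=.
  rewrite probability_setC; last exact: mE.
  rewrite -[X in (1 - X)%E]fineK; last by apply: fin_num_measure; exact: mE.
  by rewrite -EFinB /=; apply: le_lt_trans; exact: ler_norm.
apply: filterS2 hE (dim_gt0 sigmaP) => k hk dk.
exists (~` \big[setU/set0]_(i < n) ~` E k i); split.
- by apply: measurableC; apply: bigsetU_measurable => i _; exact: measurableC.
- move=> phi hphi i.
  have Ei : E k i phi.
    apply: contrapT => nE; apply: hphi.
    rewrite -(bigcup_mkord n (fun i => ~` E k i)); exists (i : nat) => //; exact: ltn_ord.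
  rewrite /E /= in Ei.
  have : unif R (~` [set j | U (phi (sigma k (enumG i) j), act (enumG i) (phi j))]) < n.+1%:R^-1.
    rewrite unif_setC // ltrBlDr -ltrBlDl; apply: lt_le_trans Ei.
    by rewrite ltrD2l ltrN2 ltf_pV2 ?posrE // ltr_nat.
  apply: le_lt_trans; apply: le_unif => j; rewrite /defect /U /= (cmetric_sym rhoP) => h1 h2.
  by rewrite ltNge h1 in h2.
rewrite setCK -lte_fin fineK; last first.
  by apply: fin_num_measure; apply: bigsetU_measurable => i _; exact: measurableC.
have := @Boole_inequality _ _ _ (mu k) (fun i => ~` E k i) n (fun i _ => measurableC (mE k i)).
move=> /le_lt_trans; apply.
apply: (@le_lt_trans _ _ (\sum_(i < n) (r / n.+1%:R)%:E)%E).
  apply: lee_sum => i _; rewrite -[leLHS]fineK; last first.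
    by apply: fin_num_measure; exact: measurableC.
  by rewrite lee_fin; exact/ltW/hk.
rewrite sumEFin sumr_const card_ord lte_fin -[ltLHS]mulr_natl mulrCA gtr_pMr //.
by rewrite ltr_pdivrMr // mul1r ltr_nat.
Qed.

End Approximation.

(** * Averages compared with the Haar integral *)

Section HaarMean.
Context {R : realType} {X : topologicalGroupType} {rho : X -> X -> R}.
Hypothesis X_compact : compact [set: X].
Hypothesis rhoP : compatible_metric rho.
Context {m : probability (borel X) R}.
Hypothesis m_haar : is_haar m.

Let cmul (w : X) : continuous (fun x : X => w * x)%g.
Proof. by apply: continuous_mulg => [x|x]; [exact: cvg_cst | exact: cvg_id]. Qed.

Lemma Rintegral_near (h : X -> R) (c E M : R) : continuous h ->
  (forall x, `|h x| <= M) -> (forall x, `|c - h x| <= E) -> `|c - \int[m]_x h x| <= E.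
Proof.
move=> ch hM hE; have mh := continuous_measurable ch.
have ih : m.-integrable setT (EFin \o h) by exact: integrable_bounded mh hM.
have ic (a : R) : m.-integrable setT (EFin \o (fun=> a)).
  by apply: (@integrable_bounded _ _ _ _ _ `|a|).
have h1 : \int[m]_x (c - E) <= \int[m]_x h x.
  by apply: le_Rintegral => // x _; have := hE x; rewrite ler_norml; lra.
have h2 : \int[m]_x h x <= \int[m]_x (c + E).
  by apply: le_Rintegral => // x _; have := hE x; rewrite ler_norml; lra.
by move: h1 h2; rewrite !Rintegral_probability_cst ler_norml; lra.
Qed.

(** By invariance, [f] and its average [h] over left translates have the same integral. Since [h]
    oscillates by at most [E], this integral is within [E] of [h 1%g], the mean of [f] over [p]. *)
Lemma haar_mean (J : finType) (p : J -> X) (f : X -> R) (E : R) : (0 < #|J|)%N ->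
  continuous f -> oscillation_le E (fun x => mean (fun w => f (p w * x)%g)) ->
  `|mean (f \o p) - \int[m]_x f x| <= E.
Proof.
move=> J0 cf fE; have [M M0 fM] := continuous_bounded X_compact cf.
pose h x := mean (fun w => f (p w * x)%g).
have cfw w : continuous (fun x => f (p w * x)%g).
  by move=> x; apply: (@continuous_comp _ _ _ (fun x => p w * x)%g f); [exact: cmul | exact: cf].
have mfw w := continuous_measurable (cfw w).
have hM x : `|h x| <= M by apply: norm_mean_le.
have ch : continuous h.
  have cs (s : seq J) : continuous (fun x => \sum_(w <- s) f (p w * x)%g).
    elim: s => [|w s IH] x.
      by under eq_fun do rewrite big_nil; exact: cvg_cst.
    by under eq_fun do rewrite big_cons; apply: cvgD; [exact: cfw | exact: IH].
  by move=> x; apply: cvgMl_tmp; exact: cs.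
have -> : \int[m]_x f x = \int[m]_x h x.
  rewrite /h /mean RintegralZl //; last first.
    apply: (@integrable_bounded _ _ _ _ _ (\sum_(w in J) M)).
      by apply: measurable_sum => w; exact: mfw.
    by move=> x; apply: le_trans (ler_norm_sum _ _ _) _; apply: ler_sum.
  rewrite (@Rintegral_sum _ _ _ _ _ _ _ (fun=> M)) //.
  under eq_bigr => w _ do rewrite (Rintegral_haar (p w) m_haar cf fM).
  by rewrite sumr_const -[X in _ * X]mulr_natl mulKf // pnatr_eq0 -lt0n.
rewrite (_ : mean (f \o p) = h 1%g); last first.
  by congr (_ * _); apply: eq_bigr => w _ /=; rewrite mulg1.
by apply: Rintegral_near ch hM _ => x; exact: fE.
Qed.

Lemma haar_dist_gt0 (G : groupType) (act : G -> X -> X) (Y : set X) :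
  closed_invariant_subgroup act Y -> Y <> setT -> 0 < \int[m]_x dist_to rho Y x.
Proof.
move=> Ysub YT; have Y0 : Y !=set0 by exists 1%g; exact: cis_1 Ysub.
have [x0 nYx0] : exists x0, ~ Y x0.
  by apply/existsNP => hY; apply: YT; apply/seteqP; split.
have cf := continuous_dist_to rhoP Y0; set f := dist_to rho Y in cf *.
have f0 x : 0 <= f x by exact: dist_to_ge0.
have [M M0 fM] := continuous_bounded X_compact cf.
have cf' : continuous (fun x => f (x0^-1 * x)%g).
  by move=> x; apply: (@continuous_comp _ _ _ (fun x => x0^-1 * x)%g f); [exact: cmul | exact: cf].
(* [Y] and [x0 Y] are disjoint, so [f] and its translate have no common zero. *)
have [|x|c c0 hc] := @continuous_pos R X X_compact (fun x => f x + f (x0^-1 * x)%g).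
- by move=> x; apply: cvgD; [exact: cf | exact: cf'].
- rewrite lt_def addr_ge0 // andbT paddr_eq0 //; apply/negP => /andP[/eqP e1 /eqP e2].
  have inY z : f z = 0 -> Y z.
    move=> fz; apply: contrapT => nYz; have := dist_to_gt0 rhoP Y0 (cis_closed Ysub) nYz.
    by rewrite -/f fz ltxx.
  apply: nYx0; rewrite -(invgK x0) -[(x0^-1)%g](mulgK x).
  by apply: (cis_inv Ysub); apply: (cis_mul Ysub); [exact: inY | apply: (cis_inv Ysub); exact: inY].
have mf := continuous_measurable cf; have mf' := continuous_measurable cf'.
have i1 : m.-integrable setT (EFin \o f) by exact: integrable_bounded mf fM.
have i2 : m.-integrable setT (EFin \o (fun x => f (x0^-1 * x)%g)).
  by apply: integrable_bounded mf' _ => x; exact: fM.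
have : \int[m]_x c <= \int[m]_x (f x + f (x0^-1 * x)%g).
  apply: le_Rintegral => //; first by apply: (@integrable_bounded _ _ _ _ _ `|c|).
  apply: (@integrable_bounded _ _ _ _ _ (M + M)); first exact: measurable_funD.
  by move=> x; apply: le_trans (ler_normD _ _) _; rewrite lerD.
(* Both summands have the same integral by invariance, so twice that integral is at least [c]. *)
rewrite Rintegral_probability_cst RintegralD // (Rintegral_haar _ m_haar cf fM); lra.
Qed.

End HaarMean.

(** * The dichotomy *)

Section Dichotomy.
Context {R : realType} {G : groupType} {d : nat -> nat}.
Context {sigma : forall k, G -> 'S_(d k)}.
Hypothesis sigmaP : sofic_approximation R sigma.
Context {X : topologicalGroupType} {act : G -> X -> X} {rho : X -> X -> R}.
Hypothesis X_compact : compact [set: X].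
Hypothesis rhoP : compatible_metric rho.
Hypothesis actP : algebraic_action act.
Hypothesis G_countable : countable [set: G].
Context {m : probability (borel X) R}.
Hypothesis m_haar : is_haar m.

Local Notation microstates := (@topological_microstates R G X act d sigma).
Local Notation configurations := (forall k, X ^^ (d k)).
Local Notation approx := (approx_microstate (sigma := sigma) (act := act) (rho := rho)).

Lemma exists_haar_limit : ergodic_commutant R sigma ->
  (forall x (e : R), 0 < e -> chargeable (sigma := sigma) (act := act) (rho := rho) x e setT) ->
  exists mu : forall k, probability (borel (X ^^ (d k))) R,
    asymptotically_supported act sigma mu /\ locally_weak_star_cvg mu m.
Proof.
move=> sigma_ergodic charge_all.
have [enumG enumGP] := countable_enum G_countable.
pose bad n (J : finType) (psi : J -> configurations) k : set 'I_(d k) :=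
  [set j | ~ forall eta f, modulus rho n.+1%:R^-1 eta f -> oscillation_le n%:R f ->
     oscillation_le (eta + n.+1%:R^-1) (fun x => mean (fun w => f (psi w k j * x)%g))].
(* Level [n] treats functions of oscillation up to [n] with tolerance [n.+1%:R^-1], so every
   continuous function is eventually covered. The index type varies with [n] and is packed with an
   element and its family. *)
have fam n : exists F : {J : finType & (J * (J -> configurations))%type},
    (forall w, microstates ((projT2 F).2 w)) /\
    \forall k \near \oo, unif R (bad n (projT1 F) (projT2 F).2 k) < n.+1%:R^-1.
  have n0 : 0 < n.+1%:R^-1 :> R by rewrite invr_gt0.
  have [J [psi [/card_gt0P[j0 _] psiP hpsi]]] :=
    mixing_family sigmaP sigma_ergodic X_compact rhoP actP charge_all n%:R n0.
  by exists (existT _ J (j0, psi)).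
have [F FP] := choice fam.
pose psi n w k : X ^^ (d k) := (projT2 (F n)).2 w k.
pose P n k := (forall w, approx enumG n (psi n w k)) /\
  unif R (bad n (projT1 (F n)) (projT2 (F n)).2 k) < n.+1%:R^-1.
have PP n : \forall k \near \oo, P n k.
  have [h1 h2] := FP n.
  have h3 : \forall k \near \oo, forall w, approx enumG n (psi n w k).
    apply: filter_forall => w.
    exact: (approx_microstate_near sigmaP X_compact rhoP enumG n (h1 w)).
  by apply: filterS2 h3 h2 => k.
have [f [foo fP]] := diagonal PP.
exists (fun k => empirical R (fun w => psi (f k) w k : borel (X ^^ (d k))) (projT2 (F (f k))).1).
have J0 k : (0 < #|projT1 (F (f k))|)%N.
  by apply/card_gt0P; exists (projT2 (F (f k))).1.
split.
  (* Every atom is an approximate microstate, so the measure in question equals 1 from some [k]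
     on. *)
  move=> g delta U delta0 oU dU; apply: cvg_near_cst.
  have [e e0 eU] := lebesgue_number rhoP X_compact dU.
  have defU := approx_microstate_defect (sigma := sigma) (act := act) (rho := rho)
    enumGP g foo e0 delta0.
  apply: filterS3 defU fP (dim_gt0 sigmaP) => k hk [fk _] dk.
  rewrite empiricalE /mean; congr (_%:E).
  rewrite (eq_bigr (fun=> 1)) => [|w _].
    by rewrite sumr_const mulVf // pnatr_eq0 -lt0n.
  rewrite indicE mem_set //= lerBlDr -lerBlDl -unif_setC //.
  apply: le_trans (ltW (hk _ (fk w))); apply: le_unif => j /= nU.
  rewrite /defect /= leNgt; apply/negP => h; apply/nU/eU.
  by rewrite (cmetric_sym rhoP).
move=> O [q [h [e [e0 hc hO]]]].
apply/(cvg_unif1 _ (dim_gt0 sigmaP)) => delta delta0.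
(* One third bounds the modulus [eta], another the tolerance of the family; their sum stays strictly
   below [e]. *)
have e30 : 0 < e / 3 by rewrite divr_gt0.
have hmod : \forall k \near \oo, forall i, modulus rho (f k).+1%:R^-1 (e / 3) (h i) /\
    oscillation_le (f k)%:R (h i).
  apply: filter_forall => i.
  have [r r0 hr] := mulg_equicontinuous rhoP X_compact (hc i) e30.
  have [M M0 hM] := continuous_bounded X_compact (hc i).
  have [N hN] : exists N : nat, M + M <= N%:R.
    by exists (Num.truncn (M + M)).+1; apply/ltW; apply: Num.Theory.truncnS_gt.
  apply: filterS2 (foo N) (near_invS foo r0) => k Nk kr; split.
    by move=> s t a b ab; apply/ltW/hr; exact: lt_trans kr.
  move=> x y; apply: le_trans (ler_normB _ _) _.
  by apply: le_trans (lerD (hM x) (hM y)) _; apply: le_trans hN _; rewrite ler_nat.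
have de0 : 0 < Num.min delta (e / 3) by rewrite lt_min delta0.
apply: filterS3 (near_invS foo de0) fP hmod => k; rewrite lt_min => /andP[kdelta ke] [_ hbad] hk.
apply: le_lt_trans (lt_trans hbad kdelta); apply: le_unif => j /= nO good.
apply: nO; apply: hO => i /=.
have [M M0 hM] := continuous_bounded X_compact (hc i).
have [hi1 hi2] := hk i.
rewrite (Rintegral_marginal _ _ (hc i) hM) (@Rintegral_empirical _ _ _ _ _ _ _ M) //; last first.
  exact: (measurableT_comp (continuous_measurable (hc i)) (@measurable_coord X (d k) j)).
have := haar_mean X_compact m_haar (J0 k) (hc i) (good _ _ hi1 hi2).
by move=> /le_lt_trans; apply; move: ke; set z := (f k).+1%:R^-1; lra.
Qed.

(** The mean distance to [Y] has expectation bounded below under [mu k], which is almost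
    concentrated on approximate microstates; some of these must therefore be far from [Y], and
    diagonalising over the tolerance gives one sequence. *)
Lemma microstate_far_from_subgroup (mu : forall k, probability (borel (X ^^ (d k))) R) (Y : set X) :
  asymptotically_supported act sigma mu -> locally_weak_star_cvg mu m ->
  closed_invariant_subgroup act Y -> Y <> setT ->
  exists2 phi : configurations, microstates phi &
  exists2 c : R, 0 < c & \forall k \near \oo,
    c <= (d k)%:R^-1 * \sum_(j < d k) dist_to rho Y (phi k j).
Proof.
move=> mu_supp mu_cvg Ysub YT.
have [enumG enumGP] := countable_enum G_countable.
have Y0 : Y !=set0 by exists 1%g; exact: cis_1 Ysub.
have cf := continuous_dist_to rhoP Y0; have f0 := dist_to_ge0 rhoP Y0.
have c0 := haar_dist_gt0 X_compact rhoP m_haar Ysub YT.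
set f := dist_to rho Y in cf f0 c0 *; set c := \int[m]_x f x in c0 *.
have [M M0 fM] := continuous_bounded X_compact cf.
pose avg k (phi : borel (X ^^ (d k))) := (d k)%:R^-1 * \sum_(j < d k) f (phi j).
have mfj k (j : 'I_(d k)) : measurable_fun [set: borel (X ^^ (d k))] (fun phi => f (phi j)).
  exact: (measurableT_comp (continuous_measurable cf) (@measurable_coord X (d k) j)).
have msum k : measurable_fun [set: borel (X ^^ (d k))] (fun phi => \sum_(j < d k) f (phi j)).
  by apply: measurable_sum.
have mavg k : measurable_fun [set: borel (X ^^ (d k))] (@avg k).
  by apply: measurable_funM.
have avgM k phi : `|avg k phi| <= M.
  rewrite /avg; case: (posnP (d k)) => [dk|dk].
    by rewrite [_^-1](_ : _ = 0) ?dk ?invr0 // mul0r normr0 ltW.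
  have := @norm_mean_le R 'I_(d k) (fun j => f (phi j)) M.
  by rewrite /mean card_ord; apply.
(* More than half of the marginals integrate [f] to at least [c / 2], and the others to at least
   0. *)
have avg_int : \forall k \near \oo, c / 4 <= \int[mu k]_phi avg k phi.
  have c20 : 0 < c / 2 by rewrite divr_gt0.
  pose O := [set nu : probability (borel X) R | `| \int[nu]_x f x - \int[m]_x f x | < c / 2].
  have nO : weak_star_nbhs m O.
    exists 1%N, (fun=> f), (c / 2); split => // nu; apply; exact: ord0.
  have /(cvg_unif1 _ (dim_gt0 sigmaP)) hO := mu_cvg _ nO.
  have half0 : 0 < 2^-1 :> R by rewrite invr_gt0.
  apply: filterS2 (hO _ half0) (dim_gt0 sigmaP) => k hk dk.
  rewrite /avg RintegralZl //; last first.
    apply: (@integrable_bounded _ _ _ _ _ (\sum_(j < d k) M)) => // phi.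
    by apply: le_trans (ler_norm_sum _ _ _) _; apply: ler_sum.
  rewrite (@Rintegral_sum _ _ _ _ _ _ _ (fun=> M)) //.
  apply: (@le_trans _ _ ((d k)%:R^-1 * \sum_(j < d k)
      c / 2 * (j \in [set j | O (marginal (mu k) j)])%:R)).
    rewrite -mulr_sumr mulrCA -unifE.
    rewrite unif_setC // ltrBlDr -ltrBlDl in hk.
    have : c / 2 * 2^-1 <= c / 2 * unif R [set j | O (marginal (mu k) j)].
      by rewrite ler_pM2l //; lra.
    by lra.
  rewrite ler_wpM2l ?invr_ge0 // ler_sum // => j _.
  rewrite -(Rintegral_marginal (mu k) j cf fM).
  case: (boolP (j \in _)) => [/set_mem|_]; last first.
    by rewrite mulr0; apply: Rintegral_ge0 => x _.
  by rewrite /O /= mulr1 -/c ltr_norml; lra.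
have h n : \forall k \near \oo, exists phi : X ^^ (d k),
    approx enumG n phi /\ c / 8 <= avg k phi.
  have e0 : 0 < c / (8 * M) by rewrite divr_gt0 // mulr_gt0.
  have hE := probability_approx_microstate sigmaP rhoP enumG actP n mu_supp e0.
  apply: filterS2 avg_int hE => k hint [E [mE EP hE]].
  apply: contrapT => /forallNP nphi.
  (* If [avg] were at most [c / 8] on [E], the complement would add less than another [c / 8],
     contradicting the lower bound [c / 4]. *)
  have : \int[mu k]_phi avg k phi <= c / 8 + M * fine (mu k (~` E)).
    apply: Rintegral_le_setC => //; last by rewrite divr_ge0 // ltW.
    move=> phi /EP phiP; rewrite leNgt; apply/negP => /ltW h.
    by apply: (nphi phi).
  have : M * fine (mu k (~` E)) < M * (c / (8 * M)) by rewrite ltr_pM2l.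
  have -> : M * (c / (8 * M)) = c / 8 by field; rewrite gt_eqF.
  lra.
have [n [noo hn]] := diagonal h.
(* For the finitely many [k] that may lack a suitable configuration, an arbitrary one is taken. *)
have wit k : exists phi : X ^^ (d k),
    (exists phi : X ^^ (d k), approx enumG (n k) phi /\ c / 8 <= avg k phi) ->
    approx enumG (n k) phi /\ c / 8 <= avg k phi.
  case: (pselect (exists phi : X ^^ (d k), approx enumG (n k) phi /\ c / 8 <= avg k phi)).
    by move=> [phi h1]; exists phi.
  by move=> no; exists point => /no.
pose phi k := projT1 (cid (wit k)).
have phiP : \forall k \near \oo, approx enumG (n k) (phi k) /\ c / 8 <= avg k (phi k).
  by apply: filterS hn => k; exact: (projT2 (cid (wit k))).
exists phi.
  apply: (approx_microstates sigmaP X_compact rhoP enumGP noo).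
  by apply: filterS phiP => k [].
exists (c / 8); first by rewrite divr_gt0.
by apply: filterS phiP => k [].
Qed.

End Dichotomy.

Theorem corollary5p5 (R : realType) (G : groupType)
    (G_countable : countable [set: G])
    (d : nat -> nat) (sigma : forall k, G -> 'S_(d k))
    (sigma_sofic : sofic_approximation R sigma)
    (sigma_ergodic : ergodic_commutant R sigma)
    (X : topologicalGroupType) (X_compact : compact [set: X])
    (act : G -> X -> X) (act_algebraic : algebraic_action act)
    (rho : X -> X -> R) (rho_metric : compatible_metric rho)
    (mX : probability (borel X) R) (mX_haar : is_haar mX) :
  (~ exists mu : forall k, probability (borel (X ^^ (d k))) R,
       asymptotically_supported act sigma mu /\ locally_weak_star_cvg mu mX)
  <->
  (exists Y : set X,
     [/\ Y <> [set: X],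
         closed_invariant_subgroup act Y &
         forall phi : forall k, X ^^ (d k),
           topological_microstates R act sigma phi ->
           exists kl : nat -> nat,
             {homo kl : m n / (m < n)%N} /\
             rho2_set rho (phi (kl l)) (@set_power X Y (d (kl l)))
               @[l --> \oo] --> (0 : R)]).
Proof.
split=> [no_mu | [Y [YT Ysub Yphi]] [mu [mu_supp mu_cvg]]].
  have [x [e [e0 nc]]] : exists x (e : R), 0 < e /\
      ~ chargeable (sigma := sigma) (act := act) (rho := rho) x e setT.
    apply: contrapT => h; apply: no_mu.
    apply: (exists_haar_limit sigma_sofic X_compact rho_metric act_algebraic) => //.
    move=> x e e0; apply: contrapT => nc; apply: h; by exists x, e.
  have [F [FU Foo FN]] :=
    nonchargeable_ultrafilter sigma_sofic X_compact rho_metric act_algebraic nc.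
  exists (charged (sigma := sigma) (act := act) (rho := rho) F); split.
  (* If [x] were charged along [F], the set of indices with many visits would be chargeable and in
     [F] at once. *)
  - move=> /seteqP[_ /(_ x I) /(_ _ e0)[phi phiP [c c0 hc]]].
    apply: FN hc; exists phi => //; exists c => //; exact: nearW.
  - exact: charged_subgroup.
  - move=> phi; exact: charged_subsequence.
have Y0 : Y !=set0 by exists 1%g; exact: cis_1 Ysub.
have [phi phiP [c c0 [N _ hN]]] := microstate_far_from_subgroup sigma_sofic X_compact
  rho_metric act_algebraic G_countable mX_haar mu_supp mu_cvg Ysub YT.
have [kl [klS /cvgrPdist_lt/(_ c c0)[N' _ hN']]] := Yphi phi phiP.
have kl_ge l : (l <= kl l)%N.
  by elim: l => // l IH; apply: leq_ltn_trans IH _; exact: klS.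
(* At this [l] both bounds apply: the distance to the power of [Y] is at least [c] and also below
   [c]. *)
pose l := maxn N N'; have Nl : (N <= kl l)%N := leq_trans (leq_maxl _ _) (kl_ge l).
have h := rho2_set_ge rho_metric Y0 (hN _ Nl).
have := hN' l (leq_maxr _ _); rewrite /= sub0r normrN.
by rewrite ger0_norm ?(le_trans (ltW c0) h) // ltNge h.
Qed.
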